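(* Let $(\Omega,\mu)$ be a $\sigma$-finite measure space, let $\mathbf{X}$ be an $\mathbf{F}^n$-directional Banach function space over $\Omega$, and let $\mathcal{P}$ be a pairwise disjoint collection of measurable sets in $\Omega$ for which $0<\mu(E)<\infty$ for all $E\in\mathcal{P}$. Then the following are equivalent: (i) $T_{\mathcal{P}}:\mathbf{X}\to\mathbf{X}$; (ii) $T_{\mathcal{P}}:\mathbf{X}[\mathcal{K}]\to\mathbf{X}[\mathcal{K}]$. Moreover, in this case $\|T_{\mathcal{P}}\|_{\mathbf{X}\to\mathbf{X}}$ and $\|T_{\mathcal{P}}\|_{\mathbf{X}[\mathcal{K}]\to\mathbf{X}[\mathcal{K}]}$ are comparable, with comparability constants depending only on $n$.
   Context: $n\ge1$ is a fixed integer, $\mathbf{F}$ is $\mathbf{R}$ or $\mathbf{C}$, $u\cdot v=\sum_{k=1}^n u_k\overline{v_k}$ on $\mathbf{F}^n$. $L^0(\Omega;\mathbf{F}^n)$ is the space of measurable functions $\Omega\to\mathbf{F}^n$ (modulo a.e. equality). $\mathcal{K}$ is the collection of non-empty closed convex $K\subseteq\mathbf{F}^n$ that are symmetric: $\lambda u\in K$ for $u\in K$, $\lambda\in\mathbf{F}$, $|\lambda|=1$. For $u\in\mathbf{F}^n$, $\mathcal{K}(u)=\{\lambda u:|\lambda|\le1\}$, and for a function $f$, $\mathcal{K}(f)(x):=\mathcal{K}(f(x))$. $L^0(\Omega;\mathcal{K})$ is the set of $F:\Omega\to\mathcal{K}$ such that $\{x:F(x)\cap E\ne\emptyset\}$ is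 measurable for every measurable (equivalently, every open) $E\subseteq\mathbf{F}^n$. $S^0(\Omega;F)$ is the set of $f\in L^0(\Omega;\mathbf{F}^n)$ with $f(x)\in F(x)$ a.e. $L^1(\Omega;\mathcal{K})$ is the set of $F\in L^0(\Omega;\mathcal{K})$ with $S^0(\Omega;F)$ bounded in $L^1(\Omega;\mathbf{F}^n)$. An $\mathbf{F}^n$-directional Banach function space $\mathbf{X}$ over $\Omega$ is a complete normed subspace of $L^0(\Omega;\mathbf{F}^n)$ with: (directional ideal property) if $f\in\mathbf{X}$, $g\in L^0(\Omega;\mathbf{F}^n)$ and $\mathcal{K}(g)(x)\subseteq\mathcal{K}(f)(x)$ a.e., then $g\in\mathbf{X}$ and $\|g\|_{\mathbf{X}}\le\|f\|_{\mathbf{X}}$; (non-degeneracy) if $g\in L^0(\Omega;\mathbf{F}^n)$ and $\int_\Omega f\cdot g\,d\mu=0$ for all $f\in\mathbf{X}$, then $g=0$ a.e. $\mathbf{X}[\mathcal{K}]$ is the set of $F\in L^0(\Omega;\mathcal{K})$ for which $S^0(\Omega;F)$ is a bounded subset of $\mathbf{X}$, with $\|F\|_{\mathbf{X}[\mathcal{K}]}:=\sup_{f\in S^0(\Omega;F)}\|f\|_{\mathbf{X}}$. For $f\in L^0(\Omega;\mathbf{F}^n)$ integrable over each $E\in\mathcal{P}$, $T_{\mathcal{P}}f:=\sum_{E\in\mathcal{P}}\langle f\rangle_E\mathbf{1}_E$ with $\langle f\rangle_E=\frac1{\mu(E)}\int_Ef\,d\mu$. For $F\in L^0(\Omega;\mathcal{K})$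 with $F\mathbf{1}_E\in L^1(\Omega;\mathcal{K})$ for each $E\in\mathcal{P}$ (where $F\mathbf{1}_E$ equals $F$ on $E$ and $\{0\}$ off $E$), $T_{\mathcal{P}}F:=\sum_{E\in\mathcal{P}}\langle F\rangle_E\mathbf{1}_E$ with $\langle F\rangle_E:=\{\langle f\rangle_E:f\in S^0(\Omega;F\mathbf{1}_E)\}$ (so $T_{\mathcal{P}}F(x)=\langle F\rangle_E$ for $x\in E\in\mathcal{P}$ and $\{0\}$ outside $\bigcup\mathcal{P}$). Writing $T_{\mathcal{P}}:\mathbf{X}\to\mathbf{X}$ (resp. $T_{\mathcal{P}}:\mathbf{X}[\mathcal{K}]\to\mathbf{X}[\mathcal{K}]$) means that $T_{\mathcal{P}}$ is well-defined on all of $\mathbf{X}$ (resp. $\mathbf{X}[\mathcal{K}]$), i.e., the required averages make sense, and satisfies a norm bound with a finite constant; the smallest constant is the operator norm. *)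

(* Defs.v *)
From HB Require Import structures.
From mathcomp Require Import all_boot all_order all_algebra.
From mathcomp Require Import all_classical all_reals all_analysis.
From mathcomp Require Import complex.

Set Implicit Arguments.
Unset Strict Implicit.
Unset Printing Implicit Defensive.

Import Order.TTheory GRing.Theory Num.Theory.
Import numFieldTopology.Exports.

Local Open Scope classical_set_scope.
Local Open Scope ring_scope.

Variant scalars := RealScalars | ComplexScalars.

Definition scalarF (R : realType) (s : scalars) : numFieldType :=
  match s with RealScalars => R | ComplexScalars => R[i] end.

Section Scalars.
Variables (R : realType) (s : scalars).
Local Notation FF := (scalarF R s).

Definition reF : FF -> R :=
  match s return scalarF R s -> R with
  | RealScalars => id | ComplexScalars => @complex.Re R
  end.

Definition imF : FF -> R :=
  match s return scalarF R s -> R with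
  | RealScalars => fun=> 0 | ComplexScalars => @complex.Im R
  end.

(* a + i b; when F is R, b is dropped, and below it is then always 0 *)
Definition mkF : R -> R -> FF :=
  match s return R -> R -> scalarF R s with
  | RealScalars => fun a _ => a | ComplexScalars => @Complex R
  end.

Definition conjF (z : FF) : FF := mkF (reF z) (- imF z).

(* `|z| lives in F; absF z is the same number in R *)
Definition absF (z : FF) : R := reF `|z|.

Definition dotF n (u v : 'rV[FF]_n) : FF := \sum_(k < n) u 0 k * conjF (v 0 k).

Definition enormF n (u : 'rV[FF]_n) : R := Num.sqrt (reF (dotF u u)).

(* The order and norm of F are used here.  When F is C, [0 <= t <= 1] in F
   says that t is real and in [0, 1], so that [convex_set] is convexity over
   the real numbers in both cases. *)
Definition KK n (K : set 'rV[FF]_n) : Prop :=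
  [/\ K !=set0, closed K, convex_set K &
      forall u (l : FF), K u -> `|l| = 1 -> K (l *: u)].

Definition Kof n (u : 'rV[FF]_n) : set 'rV[FF]_n :=
  [set l *: u | l in [set l : FF | `|l| <= 1]].

End Scalars.

Section Spaces.
Context (R : realType) (s : scalars) (n : nat).
Local Notation FF := (scalarF R s).
Local Notation V := 'rV[FF]_n.
Context (d : measure_display) (T : measurableType d)
  (mu : {sigma_finite_measure set T -> \bar R}).

(* Elements of L^0 are Borel measurable functions; the identification modulo
   a.e. equality is made in the statements about them. *)
Definition L0 (f : T -> V) : Prop :=
  measurable_fun setT (f : T -> g_sigma_algebraType (@open V)).

Definition integrableF (E : set T) (h : T -> FF) : Prop :=
  mu.-integrable E (EFin \o (@reF R s \o h)) /\
  mu.-integrable E (EFin \o (@imF R s \o h)).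

Definition integralF (E : set T) (h : T -> FF) : FF :=
  mkF s (\int[mu]_(x in E) reF (h x)) (\int[mu]_(x in E) imF (h x)).

Definition integrableV (E : set T) (f : T -> V) : Prop :=
  forall k, integrableF E (fun x => f x 0 k).

Definition integralV (E : set T) (f : T -> V) : V :=
  \row_k integralF E (fun x => f x 0 k).

Definition avg (E : set T) (f : T -> V) : V :=
  mkF s (fine (mu E))^-1 0 *: integralV E f.

(* Measurability is tested on open sets.  If mu is complete, then this is the
   same as testing on all Borel sets; if it is not, then testing on Borel sets
   is too strong: already for F = Kof \o f with f measurable, the set
   {x | F x meets B} with B Borel may be measurable only for the completion. *)
Definition L0K (F : T -> set V) : Prop :=
  (forall x, KK (F x)) /\
  (forall U : set V, open U -> measurable [set x | F x `&` U !=set0]).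

Definition S0 (F : T -> set V) : set (T -> V) :=
  [set f | L0 f /\ {ae mu, forall x, F x (f x)}].

Definition L1K (F : T -> set V) : Prop :=
  L0K F /\ exists M : R, forall f, S0 F f ->
    integrableV setT f /\ (\int[mu]_x (enormF (f x))%:E <= M%:E)%E.

Definition restrK (E : set T) (F : T -> set V) : T -> set V :=
  patch (fun=> [set 0]) E F.

Definition avgK (E : set T) (F : T -> set V) : set V :=
  [set avg E f | f in S0 (restrK E F)].

Record dirBFS := DirBFS {
  bfs_set : set (T -> V);
  bfs_norm : (T -> V) -> R;
  bfs_L0 : bfs_set `<=` L0;
  bfs_ae : forall f g, bfs_set f -> L0 g -> {ae mu, forall x, f x = g x} ->
    bfs_set g /\ bfs_norm g = bfs_norm f;
  bfs_0 : bfs_set (fun=> 0);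
  bfs_add : forall f g, bfs_set f -> bfs_set g ->
    bfs_set (fun x => f x + g x);
  bfs_scale : forall (l : FF) f, bfs_set f -> bfs_set (fun x => l *: f x);
  bfs_norm_ge0 : forall f, bfs_set f -> 0 <= bfs_norm f;
  bfs_norm_eq0 : forall f, bfs_set f -> bfs_norm f = 0 ->
    {ae mu, forall x, f x = 0};
  bfs_norm_add : forall f g, bfs_set f -> bfs_set g ->
    bfs_norm (fun x => f x + g x) <= bfs_norm f + bfs_norm g;
  bfs_norm_scale : forall (l : FF) f, bfs_set f ->
    bfs_norm (fun x => l *: f x) = absF l * bfs_norm f;
  bfs_complete : forall f_ : nat -> T -> V, (forall m, bfs_set (f_ m)) ->
    (forall e : R, 0 < e -> exists N, forall i j, (N <= i)%N -> (N <= j)%N ->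
       bfs_norm (fun x => f_ i x - f_ j x) < e) ->
    exists2 f, bfs_set f &
      (fun m => bfs_norm (fun x => f_ m x - f x)) @ \oo --> (0 : R);
  bfs_ideal : forall f g, bfs_set f -> L0 g ->
    {ae mu, forall x, Kof (g x) `<=` Kof (f x)} ->
    bfs_set g /\ bfs_norm g <= bfs_norm f;
  bfs_nondegenerate : forall g, L0 g ->
    (forall f, bfs_set f -> integrableF setT (fun x => dotF (f x) (g x)) /\
       integralF setT (fun x => dotF (f x) (g x)) = 0) ->
    {ae mu, forall x, g x = 0}
}.

Variable X : dirBFS.

Definition XK (F : T -> set V) : Prop :=
  [/\ L0K F, S0 F `<=` bfs_set X &
      exists M : R, forall f, S0 F f -> bfs_norm X f <= M].

Definition normXK (F : T -> set V) : R := sup [set bfs_norm X f | f in S0 F].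

Variable P : set (set T).

(* At each x at most one term of the sum is nonzero when P is disjoint. *)
Definition TP (f : T -> V) : T -> V :=
  fun x => \sum_(E \in P) (\1_E x : FF) *: avg E f.

Definition TPK (F : T -> set V) : T -> set V := fun x =>
  [set v | (exists E, [/\ P E, E x & avgK E F v]) \/
           (~ (exists2 E, P E & E x) /\ v = 0)].

Definition TP_bound (C : R) : Prop :=
  0 <= C /\ forall f, bfs_set X f -> bfs_norm X (TP f) <= C * bfs_norm X f.

Definition TPK_bound (C : R) : Prop :=
  0 <= C /\ forall F, XK F -> normXK (TPK F) <= C * normXK F.

Definition TP_bounded : Prop :=
  [/\ forall f, bfs_set X f -> forall E, P E -> integrableV E f,
      forall f, bfs_set X f -> bfs_set X (TP f) &
      exists C, TP_bound C].

Definition TPK_bounded : Prop :=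
  [/\ forall F, XK F -> forall E, P E -> L1K (restrK E F),
      forall F, XK F -> XK (TPK F) &
      exists C, TPK_bound C].

Definition TP_norm : R := inf [set C | TP_bound C].

Definition TPK_norm : R := inf [set C | TPK_bound C].

End Spaces.

(* Main.v *)
Require Import Defs.
From HB Require Import structures.
From mathcomp Require Import all_boot all_order all_algebra.
From mathcomp Require Import all_classical all_reals all_analysis.
From mathcomp Require Import complex measurable_realfun.
From mathcomp Require Import ring lra.

Import Order.TTheory GRing.Theory Num.Theory.
Import numFieldTopology.Exports.
Local Open Scope classical_set_scope.
Local Open Scope ring_scope.
Set Implicit Arguments.
Unset Strict Implicit.
Unset Printing Implicit Defensive.

(** Why the theorem holds.

    From sets to functions.  A function f of X is a selection of the
    set-valued function x |-> K(f(x)).  By the ideal property every selection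
    of it lies in X with norm at most that of f, and T_P f is a selection of
    T_P (K o f).  So a bound for T_P on X[K] is a bound for T_P on X with the
    same constant ([TPK_bounded_TP], [TPK_bound_TP]).

    From functions to sets.  Let F belong to X[K] and let E be a cell of P.
    - Integrability.  Multiplying a selection f by a measurable function with
      values 1 and -1 makes a prescribed real coordinate nonnegative and gives
      another selection g, so the integral of the absolute value of this
      coordinate over E is mu(E) times a coordinate of an average.  Averages over
      E are bounded: <g>_E 1_E is dominated by T_P g, and v |-> ||v 1_E||_X is a norm
      on a subspace of F^n, hence controls the size of v ([norm_bound],
      [avg_bound], [integral_l1norm_bounded]).
    - The average <F>_E is convex and symmetric because the set of selections
      is.  It is closed ([avg_attained]): if averages of selections f_j
      tend to v, the supremum over j of |f_j| is integrable, because a pointwise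
      maximum of finitely many selections is a selection.  Among the selections
      dominated by this majorant whose average is almost v, nearly minimize the
      quadratic energy with weight the inverse of the majorant.  By the
      parallelogram identity a minimizing sequence converges fast, hence almost
      everywhere, and by dominated convergence the average of the limit is v.
    - Norm bound.  A nonempty bounded set in F^n contains n points, not
      necessarily distinct, such that each of its points is a combination of these n, with coefficients bounded in terms of
      n only and linear in the point ([near_basis]).  Apply this to <F>_E, for
      every cell, and glue the selections that represent the n points over the
      cells: this gives n selections f_1, ..., f_n of F such that every
      selection of T_P F is a sum of n terms, the j-th pointwise bounded by a
      constant times T_P f_j.  The ideal property and the bound for T_P on X
      conclude ([TPK_selection]).  *)

(** * Scalars *)

Section ScalarLemmas.
Variables (R : realType) (s : scalars).
Local Notation FF := (scalarF R s).

(** The real numbers inside F.  Every formula below in [reF] and [imF] holds for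
    both fields, because over the reals [imF] vanishes identically. *)
Definition ofR (a : R) : FF := mkF s a 0.

Lemma reF_D : {morph @reF R s : x y / x + y}.
Proof. by case: s => //= -[a b] [c d]. Qed.
Lemma imF_D : {morph @imF R s : x y / x + y}.
Proof. by case: s => //= [x y|-[a b] [c d]] //; rewrite addr0. Qed.
Lemma reF_M (x y : FF) : reF (x * y) = reF x * reF y - imF x * imF y.
Proof. by case: s x y => //= [x y|[a b] [c d]] //; rewrite mulr0 subr0. Qed.
Lemma imF_M (x y : FF) : imF (x * y) = reF x * imF y + imF x * reF y.
Proof. by case: s x y => //= [x y|[a b] [c d]] //; rewrite mulr0 mul0r addr0. Qed.
Lemma reF0 : reF (0 : FF) = 0. Proof. by case: s. Qed.
Lemma imF0 : imF (0 : FF) = 0. Proof. by case: s. Qed.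
Lemma mkF_eta (x : FF) : mkF s (reF x) (imF x) = x.
Proof. by case: s x => //= -[]. Qed.
Lemma reF_mk (a b : R) : reF (mkF s a b) = a. Proof. by case: s. Qed.
Lemma imF_mk0 (a : R) : imF (mkF s a 0) = 0. Proof. by case: s. Qed.
Lemma FF_eq (x y : FF) : reF x = reF y -> imF x = imF y -> x = y.
Proof. by move=> e1 e2; rewrite -(mkF_eta x) e1 e2 mkF_eta. Qed.
Lemma reF_N (x : FF) : reF (- x) = - reF x.
Proof. by case: s x => //= -[]. Qed.
Lemma imF_N (x : FF) : imF (- x) = - imF x.
Proof. by case: s x => //= [_|[]//]; rewrite oppr0. Qed.

Lemma reF_of a : reF (ofR a) = a. Proof. exact: reF_mk. Qed.
Lemma imF_of a : imF (ofR a) = 0. Proof. exact: imF_mk0. Qed.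
Lemma ofR0 : ofR 0 = 0. Proof. by rewrite /ofR; case: s. Qed.
Lemma ofR1 : ofR 1 = 1. Proof. by rewrite /ofR; case: s. Qed.
Lemma ofRD a b : ofR (a + b) = ofR a + ofR b.
Proof. by apply: FF_eq; rewrite ?reF_D ?imF_D ?reF_of ?imF_of ?addr0. Qed.
Lemma ofRN a : ofR (- a) = - ofR a.
Proof. by apply: FF_eq; rewrite ?reF_N ?imF_N ?reF_of ?imF_of ?oppr0. Qed.
Lemma ofRM a b : ofR (a * b) = ofR a * ofR b.
Proof.
by apply: FF_eq; rewrite ?reF_M ?imF_M ?reF_of ?imF_of ?(mulr0, mul0r, subr0, addr0).
Qed.
Lemma ofR_inj : injective ofR.
Proof. by move=> a b /(congr1 (@reF R s)); rewrite !reF_of. Qed.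

Lemma ofR_le a b : (ofR a <= ofR b) = (a <= b).
Proof. by rewrite /ofR; case: s => //=; rewrite lecE /= eqxx. Qed.
Lemma ofR_lt a b : (ofR a < ofR b) = (a < b).
Proof. by rewrite !lt_neqAle ofR_le (inj_eq ofR_inj). Qed.
Lemma ge0_ofR (x : FF) : 0 <= x -> x = ofR (reF x).
Proof.
move=> x0; apply: FF_eq; rewrite ?reF_of ?imF_of //.
by case: s x x0 => //= -[a b]; rewrite lecE /= => /andP[/eqP].
Qed.
Lemma ofR_abs (x : FF) : ofR (absF x) = `|x|.
Proof. by rewrite /absF -ge0_ofR. Qed.
Lemma absF_ge0 (x : FF) : 0 <= absF x.
Proof. by rewrite -ofR_le ofR0 ofR_abs. Qed.
Lemma absF_M (x y : FF) : absF (x * y) = absF x * absF y.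
Proof. by apply: ofR_inj; rewrite ofRM !ofR_abs normrM. Qed.
Lemma absF_D (x y : FF) : absF (x + y) <= absF x + absF y.
Proof. by rewrite -ofR_le ofRD !ofR_abs ler_normD. Qed.
Lemma absF_eq0 (x : FF) : (absF x == 0) = (x == 0).
Proof. by rewrite -(inj_eq ofR_inj) ofR_abs ofR0 normr_eq0. Qed.
Lemma absF_0 : absF (0 : FF) = 0.
Proof. by apply/eqP; rewrite absF_eq0. Qed.
Lemma absF_N (x : FF) : absF (- x) = absF x.
Proof. by apply: ofR_inj; rewrite !ofR_abs normrN. Qed.
Lemma absF_V (x : FF) : absF x^-1 = (absF x)^-1.
Proof.
have [->|x0] := eqVneq x 0; first by rewrite invr0 absF_0 invr0.
apply: (@mulfI _ (absF x)); first by rewrite absF_eq0.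
rewrite -absF_M !divff ?absF_eq0 // /absF normr1 -ofR1 reF_of //.
Qed.
Lemma absF_of (a : R) : absF (ofR a) = `|a|.
Proof.
wlog a0 : a / 0 <= a => [hw|].
  by have [/hw//|/ltW a0] := leP 0 a; rewrite -absF_N -ofRN hw ?oppr_ge0 ?normrN.
by apply: ofR_inj; rewrite ofR_abs !ger0_norm // -ofR0 ofR_le.
Qed.
Lemma absF_le (x : FF) r : (absF x <= r) = (`|x| <= ofR r).
Proof. by rewrite -ofR_le ofR_abs. Qed.
Lemma absF_sqr (x : FF) : absF x ^+ 2 = reF x ^+ 2 + imF x ^+ 2.
Proof.
case: s x => [x|[a b]]; rewrite /absF /=; first by rewrite real_normK ?num_real // expr0n addr0.
by rewrite sqr_sqrtr // addr_ge0 // sqr_ge0.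
Qed.
Lemma reF_abs (x : FF) : `|reF x| <= absF x.
Proof.
rewrite -(@ler_pXn2r _ 2) ?nnegrE ?absF_ge0 // absF_sqr real_normK ?num_real //.
by rewrite lerDl sqr_ge0.
Qed.
Lemma imF_abs (x : FF) : `|imF x| <= absF x.
Proof.
rewrite -(@ler_pXn2r _ 2) ?nnegrE ?absF_ge0 // absF_sqr real_normK ?num_real //.
by rewrite lerDr sqr_ge0.
Qed.
Lemma absF_ub (x : FF) : absF x <= `|reF x| + `|imF x|.
Proof.
rewrite -(@ler_pXn2r _ 2) ?nnegrE ?absF_ge0 ?addr_ge0 // absF_sqr sqrrD.
by rewrite !real_normK ?num_real // addrAC lerDl mulrn_wge0 ?mulr_ge0.
Qed.

End ScalarLemmas.

(** * Real coordinates and the topology of F^n *)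

(** The denominator is increased by one so that an empty index type is allowed. *)
Lemma sum_lt_card (R : realType) (I : finType) (a : I -> R) (e : R) : 0 < e ->
  (forall i, a i <= e / (#|I|%:R + 1)) -> \sum_i a i < e.
Proof.
move=> e0 ae; have N0 : (0 : R) < #|I|%:R + 1 by rewrite ltr_wpDl.
apply: (@le_lt_trans _ _ (\sum_(i : I) e / (#|I|%:R + 1))); first exact: ler_sum.
rewrite sumr_const -[ltLHS]mulr_natr -mulrA gtr_pMr // mulrC ltr_pdivrMr //.
by rewrite mul1r ltrDl.
Qed.

Section RealCoordinates.
Variables (R : realType) (s : scalars) (n : nat).
Local Notation FF := (scalarF R s).
Local Notation V := 'rV[FF]_n.
Local Notation I := ('I_n * bool)%type.
Local Notation ofR := (@ofR R s).
Implicit Types (u v w : V) (i : I) (l : FF).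

(** The 2n real coordinates of a vector.  Over the reals the n imaginary ones
    are kept, although they are zero, so that both fields have one index type. *)
Definition rcoord (u : V) (i : I) : R :=
  if i.2 then imF (u 0 i.1) else reF (u 0 i.1).

Definition of_rcoord (a : I -> R) : V := \row_k mkF s (a (k, false)) (a (k, true)).

(** [of_rcoord] forgets imaginary parts when F is R; then it inverts [rcoord]
    only up to these factors, 0 on the imaginary coordinates and 1 otherwise. *)
Definition coord_weight (i : I) : R := if i.2 then imF (mkF s 0 1) else 1.

(** Being a sum over coordinates, this norm passes through integrals and
    measurability statements more easily than the Euclidean one. *)
Definition l1norm (u : V) : R := \sum_i `|rcoord u i|.

Lemma rcoordD u v i : rcoord (u + v) i = rcoord u i + rcoord v i.
Proof. by rewrite /rcoord !mxE; case: i.2; rewrite ?imF_D ?reF_D. Qed.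
Lemma rcoordN u i : rcoord (- u) i = - rcoord u i.
Proof. by rewrite /rcoord !mxE; case: i.2; rewrite ?imF_N ?reF_N. Qed.
Lemma rcoordB u v i : rcoord (u - v) i = rcoord u i - rcoord v i.
Proof. by rewrite rcoordD rcoordN. Qed.
Lemma rcoord0 i : rcoord 0 i = 0.
Proof. by rewrite /rcoord !mxE; case: i.2; rewrite ?imF0 ?reF0. Qed.
Lemma rcoordZ a u i : rcoord (ofR a *: u) i = a * rcoord u i.
Proof.
by rewrite /rcoord !mxE; case: i.2; rewrite ?imF_M ?reF_M reF_of imF_of !mul0r ?addr0 ?subr0.
Qed.
Lemma rcoord_eq u v : (forall i, rcoord u i = rcoord v i) -> u = v.
Proof.
move=> uv; apply/rowP => k; apply: FF_eq.
- exact: uv (k, false).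
- exact: uv (k, true).
Qed.
Lemma rcoordK u : of_rcoord (rcoord u) = u.
Proof. by apply/rowP => k; rewrite mxE /rcoord /= mkF_eta. Qed.
Lemma rcoord_of_rcoord a i : rcoord (of_rcoord a) i = coord_weight i * a i.
Proof.
case: i => k b; rewrite /rcoord /coord_weight /= mxE; case: b => /=; rewrite ?reF_mk ?mul1r //.
by rewrite /imF /mkF; case: s => /=; rewrite ?mul0r ?mul1r.
Qed.
Lemma coord_weight01 i : 0 <= coord_weight i <= 1.
Proof.
rewrite /coord_weight; case: i.2; rewrite ?ler01 ?lexx //.
by rewrite /imF /mkF; case: s => /=; rewrite ?lexx ler01.
Qed.
Lemma coord_weight_rcoord u i : coord_weight i * rcoord u i = rcoord u i.
Proof. by rewrite -[in RHS](rcoordK u) rcoord_of_rcoord. Qed.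

Lemma rcoord_le_l1norm u i : `|rcoord u i| <= l1norm u.
Proof. by rewrite /l1norm (bigD1 i) //= lerDl sumr_ge0. Qed.
Lemma l1norm_ge0 u : 0 <= l1norm u. Proof. exact: sumr_ge0. Qed.
Lemma l1norm0 : l1norm 0 = 0.
Proof. by rewrite /l1norm big1 // => i _; rewrite rcoord0 normr0. Qed.
Lemma l1normN u : l1norm (- u) = l1norm u.
Proof. by apply: eq_bigr => i _; rewrite rcoordN normrN. Qed.
Lemma l1normB u v : l1norm (u - v) = l1norm (v - u).
Proof. by rewrite -l1normN opprB. Qed.
Lemma l1normD u v : l1norm (u + v) <= l1norm u + l1norm v.
Proof. by rewrite /l1norm -big_split /=; apply: ler_sum => i _; rewrite rcoordD ler_normD. Qed.
Lemma l1norm_triangle u v w : l1norm (u - w) <= l1norm (u - v) + l1norm (v - w).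
Proof. by have := l1normD (u - v) (v - w); rewrite addrA subrK. Qed.
Lemma l1norm_ofR a u : l1norm (ofR a *: u) = `|a| * l1norm u.
Proof. by rewrite /l1norm mulr_sumr; apply: eq_bigr => i _; rewrite rcoordZ normrM. Qed.
Lemma l1norm_eq0 u : l1norm u = 0 -> u = 0.
Proof.
move=> u0; apply: rcoord_eq => i; rewrite rcoord0; apply/eqP.
by rewrite -normr_le0 -u0 rcoord_le_l1norm.
Qed.
Lemma l1norm_sumE u : l1norm u = \sum_k (`|reF (u 0 k)| + `|imF (u 0 k)|).
Proof.
rewrite /l1norm -(pair_bigA _ (fun k b => `|rcoord u (k, b)|)) /=.
by apply: eq_bigr => k _; rewrite big_bool /= addrC.
Qed.
Lemma absF_le_l1norm u k : absF (u 0 k) <= l1norm u.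
Proof.
rewrite l1norm_sumE (bigD1 k) //= (le_trans (absF_ub _)) // lerDl.
by apply: sumr_ge0 => j _; rewrite addr_ge0.
Qed.
Lemma l1norm_le_absF u : l1norm u <= \sum_k 2 * absF (u 0 k).
Proof.
by rewrite l1norm_sumE ler_sum // => k _; rewrite mulr2n mulrDl mul1r lerD ?reF_abs ?imF_abs.
Qed.
Lemma l1normZ l u : l1norm (l *: u) <= 2 * absF l * l1norm u.
Proof.
rewrite !l1norm_sumE mulr_sumr ler_sum // => k _; rewrite mxE reF_M imF_M.
have := reF_abs l; have := imF_abs l.
set a := reF l; set b := imF l; set c := reF _; set e := imF _ => lb la.
have : `|a * c - b * e| <= absF l * `|c| + absF l * `|e|.
  by rewrite (le_trans (ler_normB _ _)) // !normrM lerD // ler_wpM2r.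
have : `|a * e + b * c| <= absF l * `|e| + absF l * `|c|.
  by rewrite (le_trans (ler_normD _ _)) // !normrM lerD // ler_wpM2r.
lra.
Qed.

Lemma dot_rcoord u : reF (dotF u u) = \sum_i rcoord u i ^+ 2.
Proof.
have -> : reF (dotF u u) = \sum_k reF (u 0 k * conjF (u 0 k)).
  by rewrite /dotF; elim/big_rec2: _ => [|k a b _ <-]; rewrite ?reF0 ?reF_D.
rewrite -(pair_bigA _ (fun k b => rcoord u (k, b) ^+ 2)) /=.
apply: eq_bigr => k _; rewrite big_bool /= /rcoord /= reF_M /conjF reF_mk.
have -> : imF (u 0 k) * imF (mkF s (reF (u 0 k)) (- imF (u 0 k))) = - imF (u 0 k) ^+ 2.
  by case: s u => u /=; rewrite ?mul0r ?expr0n ?oppr0 //= mulrN.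
by rewrite opprK addrC -expr2.
Qed.
Lemma enorm_ge0 u : 0 <= enormF u. Proof. exact: sqrtr_ge0. Qed.
Lemma enorm_le_l1norm u : enormF u <= l1norm u.
Proof.
rewrite -[l1norm u]ger0_norm ?l1norm_ge0 // -sqrtr_sqr /enormF dot_rcoord ler_wsqrtr //.
rewrite expr2 [X in X * _]/l1norm mulr_suml ler_sum // => i _.
by rewrite -[rcoord u i ^+ 2]ger0_norm ?sqr_ge0 // expr2 normrM ler_wpM2l ?rcoord_le_l1norm.
Qed.

Lemma ballF (x y e : FF) : ball x e y = (`|x - y| < e) :> Prop.
Proof. by []. Qed.
(** The topology of F^n is that of the maximum norm, with radii in F; it is
    equivalent to [l1norm], and a positive element of F is a positive real. *)
Lemma nbhs_l1norm (u : V) (A : set V) :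
  nbhs u A <-> exists e : R, 0 < e /\ forall v, l1norm (v - u) < e -> A v.
Proof.
split.
  move=> /nbhs_ballP [e /= e0 eA]; have re0 : 0 < reF e.
    by rewrite -(ofR_lt s) -ge0_ofR ?ltW // ofR0.
  exists (reF e); split => // v vu; apply: eA; split => // i j.
  rewrite ord1 ballF distrC.
  rewrite -ofR_abs [e]ge0_ofR ?ltW // ofR_lt (le_lt_trans _ vu) //.
  by have := absF_le_l1norm (v - u) j; rewrite !mxE.
move=> [e [e0 eA]]; apply/nbhs_ballP.
have N0 : (0 : R) < #|'I_n|%:R + 1 by rewrite ltr_wpDl.
have e1 : 0 < e / (#|'I_n|%:R + 1) / 2 by rewrite !divr_gt0.
exists (ofR (e / (#|'I_n|%:R + 1) / 2)); first by rewrite /= -(ofR0 R s) ofR_lt.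
move=> v [_ uv]; apply: eA; apply: le_lt_trans (l1norm_le_absF _) _.
apply: sum_lt_card => // k; rewrite mulrC -ler_pdivlMr //.
rewrite -(ofR_le s) ofR_abs !mxE distrC ltW //.
by have := uv 0 k; rewrite ballF.
Qed.

Lemma open_l1norm (A : set V) :
  open A <-> forall u, A u -> exists e : R, 0 < e /\ forall v, l1norm (v - u) < e -> A v.
Proof.
rewrite openE; split => [oA u /oA|oA u /oA]; first by move/nbhs_l1norm.
by move=> ?; apply/nbhs_l1norm.
Qed.

Lemma closed_l1norm (A : set V) :
  closed A <-> forall u, (forall e : R, 0 < e -> exists2 v, A v & l1norm (v - u) < e) -> A u.
Proof.
split => cA u; last first.
  move=> clu; apply: cA => e e0.
  have /clu [v []] : nbhs u [set v | l1norm (v - u) < e] by apply/nbhs_l1norm; exists e.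
  by exists v.
move=> uA; apply: cA => B /nbhs_l1norm [e [e0 eB]].
by have [v Av /eB] := uA e e0; exists v.
Qed.

End RealCoordinates.

(** * Measurability *)

Lemma countable_bigcup_measurable d (T : measurableType d) (U : Type) (D : set U)
    (F : U -> set T) :
  countable D -> (forall i, D i -> measurable (F i)) ->
  measurable (\bigcup_(i in D) F i).
Proof.
move=> /countable_injP[g ginj] mF.
have -> : \bigcup_(i in D) F i = \bigcup_k \bigcup_(i in D `&` [set i | g i = k]) F i.
  apply/seteqP; split => x [i Di Fx]; first by exists (g i) => //; exists i.
  by case: Fx => j [Dj _] Fjx; exists j.
apply: bigcupT_measurable => k.
have [[i [Di gi]]|no] := pselect (exists i, D i /\ g i = k).
  rewrite (_ : _ `&` _ = [set i]) ?bigcup_set1; first exact: mF.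
  apply/seteqP; split => [j [Dj /= gj]|j ->] //=.
  by apply: ginj; rewrite ?inE // gj.
rewrite (_ : _ `&` _ = set0) ?bigcup_set0 //.
by apply/seteqP; split => // j [Dj /= gj]; apply: no; exists j.
Qed.

Section MeasurableSets.
Context (d : measure_display) (T : measurableType d) (R : realType).

Lemma measurable_Prop (Q : Prop) : measurable [set _ : T | Q].
Proof.
have [HQ|HQ] := pselect Q.
  rewrite (_ : [set _ | _] = setT); first exact: measurableT.
  by apply/seteqP; split.
rewrite (_ : [set _ | _] = set0); first exact: measurable0.
by apply/seteqP; split.
Qed.

Lemma measurable_set_lt (a b : T -> R) :
  measurable_fun setT a -> measurable_fun setT b -> measurable [set x | a x < b x].
Proof.
move=> ma mb; rewrite -[X in measurable X]setTI.
have -> : [set x | a x < b x] = (fun x => a x < b x) @^-1` [set true].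
  by apply/seteqP; split => x /=; [move->|].
by apply: measurable_fun_ltr.
Qed.

Lemma measurable_set_le (a b : T -> R) :
  measurable_fun setT a -> measurable_fun setT b -> measurable [set x | a x <= b x].
Proof.
move=> ma mb; have -> : [set x | a x <= b x] = ~` [set x | b x < a x].
  by apply/seteqP; split => x /=; rewrite leNgt => /negP.
by apply: measurableC; exact: measurable_set_lt.
Qed.

Lemma measurable_fun_inv_gt0 (h : T -> R) :
  (forall x, 0 < h x) -> measurable_fun setT h -> measurable_fun setT (fun x => (h x)^-1).
Proof.
move=> h0 mh; rewrite (_ : (fun x => (h x)^-1) = (@powR R ^~ (-1)) \o h).
  exact: measurableT_comp.
by apply/funext => x /=; rewrite powR_inv1 // ltW.
Qed.

End MeasurableSets.

Section MeasurableVectors.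
Variables (R : realType) (s : scalars) (n : nat).
Context (d : measure_display) (T : measurableType d).
Local Notation FF := (scalarF R s).
Local Notation V := 'rV[FF]_n.
Local Notation I := ('I_n * bool)%type.
Local Notation ofR := (@ofR R s).

Lemma of_rcoord_dist (a b : I -> R) :
  l1norm (of_rcoord s a - of_rcoord s b) <= \sum_i `|a i - b i|.
Proof.
apply: ler_sum => i _; rewrite rcoordB !rcoord_of_rcoord -mulrBr normrM.
have /andP[s0 s1] := coord_weight01 R s i.
by rewrite (ger0_norm s0) ler_piMl.
Qed.

Lemma rat_dense (u : V) (e : R) : 0 < e ->
  exists q : {ffun I -> rat}, l1norm (u - of_rcoord s (fun i => ratr (q i))) < e.
Proof.
move=> e0; have N0 : (0 : R) < #|{: I}|%:R + 1 by rewrite ltr_wpDl.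
have H i : exists r : rat, `|rcoord u i - ratr r| < e / (#|{: I}|%:R + 1).
  have [|r /=] := @rat_in_itvoo R (rcoord u i - e / (#|{: I}|%:R + 1)) (rcoord u i).
    by rewrite ltrBlDr ltrDl divr_gt0.
  rewrite in_itv /= => /andP[h1 h2]; exists r; rewrite ger0_norm; lra.
have /choice [q qH] := H.
exists [ffun i => q i]; rewrite -[u]rcoordK; apply: le_lt_trans (of_rcoord_dist _ _) _.
by apply: sum_lt_card => // i; rewrite ffunE ltW.
Qed.

Lemma measurable_rcoord (i : I) :
  measurable_fun setT (fun u : g_sigma_algebraType (@open V) => rcoord (u : V) i).
Proof.
move=> mD.
apply: (measurability _ (measurable_realfun.RGenOInfty.measurableE R)) => //.
move=> _ [_ [x ->] <-].
rewrite setTI; apply: sub_sigma_algebra; apply/open_l1norm => u /=.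
rewrite in_itv /= andbT => xu.
exists (rcoord u i - x); split; first by rewrite subr_gt0.
move=> v vu; have := le_lt_trans (rcoord_le_l1norm (v - u) i) vu.
by rewrite rcoordB ltr_norml in_itv /= andbT; lra.
Qed.

Lemma measurable_l1norm_coords (f : T -> V) (v : V) :
  (forall i, measurable_fun setT (fun x => rcoord (f x) i)) ->
  measurable_fun setT (fun x => l1norm (f x - v)).
Proof.
move=> mf; rewrite /l1norm; apply: measurable_sum => i.
apply: measurableT_comp => //.
under eq_fun do rewrite rcoordB.
by apply: measurable_funB.
Qed.

(** Coordinates are continuous, hence Borel.  Conversely an open set is a union
    of balls with rational centers and radii 1/(k+1), of which there are countably
    many, and the preimage of a ball is measurable when the coordinates are. *)
Lemma L0P (f : T -> V) :
  L0 f <-> forall i, measurable_fun setT (fun x => rcoord (f x) i).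
Proof.
split => [mf i|mf].
  by have := measurableT_comp (measurable_rcoord i) mf.
rewrite /L0; apply: (@measurability _ _ T (g_sigma_algebraType (@open V)) setT f
  (@open V) erefl) => _ [U oU <-]; rewrite setTI.
pose B (qk : {ffun I -> rat} * nat) : set V :=
  [set u | l1norm (u - of_rcoord s (fun i => ratr (qk.1 i))) < qk.2.+1%:R^-1].
have -> : f @^-1` U = \bigcup_(qk in [set qk | B qk `<=` U]) (f @^-1` B qk).
  apply/seteqP; split => x /=; last by move=> [qk qU /qU].
  move=> Ufx; have [e [e0 eU]] := (open_l1norm U).1 oU _ Ufx.
  have [k ke] : exists k, k.+1%:R^-1 < e / 2.
    have [k _ kH] := near_infty_natSinv_lt (PosNum (divr_gt0 e0 (ltr0Sn R 1))).
    by exists k; apply: kH => /=.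
  have [|q qf] := @rat_dense (f x) (k.+1%:R^-1); first by [].
  exists (q, k) => //= v; rewrite /B /= => vq; apply: eU.
  apply: le_lt_trans (l1norm_triangle _ (of_rcoord s (fun i => ratr (q i))) _) _.
  by rewrite [X in _ + X]l1normB [e]splitr ltrD // (lt_trans _ ke).
apply: countable_bigcup_measurable => // qk _.
rewrite -[X in measurable X]setTI.
have -> : f @^-1` B qk =
    (fun x => l1norm (f x - of_rcoord s (fun i => ratr (qk.1 i)))) @^-1`
      `]-oo, qk.2.+1%:R^-1[.
  by apply/seteqP; split => x; rewrite /B /= in_itv.
by apply: measurable_l1norm_coords.
Qed.

Definition measF (c : T -> FF) : Prop :=
  measurable_fun setT (fun x => reF (c x)) /\ measurable_fun setT (fun x => imF (c x)).

Lemma measF_coord (f : T -> V) : L0 f <-> forall k, measF (fun x => f x 0 k).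
Proof.
split => [/L0P mf k|mf]; first by split; [exact: (mf (k, false))|exact: (mf (k, true))].
by apply/L0P => -[k []]; have [] := mf k.
Qed.

Lemma measF_cst (c : FF) : measF (fun=> c).
Proof. by split; exact: measurable_cst. Qed.

Lemma measF_D (a b : T -> FF) : measF a -> measF b -> measF (fun x => a x + b x).
Proof.
move=> [a1 a2] [b1 b2]; split.
- by under eq_fun do rewrite reF_D; exact: measurable_funD.
- by under eq_fun do rewrite imF_D; exact: measurable_funD.
Qed.

Lemma measF_M (a b : T -> FF) : measF a -> measF b -> measF (fun x => a x * b x).
Proof.
move=> [a1 a2] [b1 b2]; split.
- by under eq_fun do rewrite reF_M; apply: measurable_funB; exact: measurable_funM.
- by under eq_fun do rewrite imF_M; apply: measurable_funD; exact: measurable_funM.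
Qed.

Lemma measF_sum (J : Type) (r : seq J) (a : J -> T -> FF) :
  (forall j, measF (a j)) -> measF (fun x => \sum_(j <- r) a j x).
Proof.
move=> ma; elim: r => [|j r IH].
  by under eq_fun do rewrite big_nil; exact: measF_cst.
by under eq_fun do rewrite big_cons; exact: measF_D.
Qed.

Lemma L0_cst (v : V) : L0 (fun _ : T => v).
Proof. exact: measurable_cst. Qed.

Lemma L0_D (f g : T -> V) : L0 f -> L0 g -> L0 (fun x => f x + g x).
Proof.
move=> /measF_coord mf /measF_coord mg; apply/measF_coord => k.
by under eq_fun do rewrite mxE; exact: measF_D.
Qed.

Lemma L0_Z (c : T -> FF) (f : T -> V) : measF c -> L0 f -> L0 (fun x => c x *: f x).
Proof.
move=> mc /measF_coord mf; apply/measF_coord => k.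
by under eq_fun do rewrite mxE; exact: measF_M.
Qed.

Lemma measF_mulmx m (f : T -> V) (L : 'M[FF]_(n, m)) j :
  L0 f -> measF (fun x => (f x *m L) 0 j).
Proof.
move=> /measF_coord mf; under eq_fun do rewrite mxE.
by apply: measF_sum => k; apply: measF_M => //; exact: measF_cst.
Qed.

Lemma measurable_l1norm (f : T -> V) : L0 f -> measurable_fun setT (fun x => l1norm (f x)).
Proof.
move=> /L0P mf; have := measurable_l1norm_coords 0 mf.
by under eq_fun do rewrite subr0.
Qed.

Definition piece (A : set T) (f g : T -> V) : T -> V :=
  fun x => if x \in A then f x else g x.

Lemma L0_piece (A : set T) (f g : T -> V) :
  measurable A -> L0 f -> L0 g -> L0 (piece A f g).
Proof.
move=> mA mf mg _ Y mY; rewrite setTI.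
have -> : piece A f g @^-1` Y = (A `&` (f @^-1` Y)) `|` (~` A `&` (g @^-1` Y)).
  apply/seteqP; split => x /=; rewrite /piece; case: ifPn.
  - by rewrite inE; left.
  - by rewrite notin_setE; right.
  - by rewrite inE => Ax [[]|[]].
  - by rewrite notin_setE => Ax [[]|[]].
apply: measurableU; apply: measurableI => //.
- by rewrite -[X in measurable X]setTI; exact: mf.
- exact: measurableC.
- by rewrite -[X in measurable X]setTI; exact: mg.
Qed.

(** The chosen value is unambiguous when P is disjoint; 0 is the value outside all
    members of P. *)
Definition glueV (P : set (set T)) (G : set T -> T -> V) : T -> V :=
  fun x => xget 0 [set v | exists E, [/\ P E, E x & v = G E x]].

Lemma glueV_in P G E x : trivIset P id -> P E -> E x -> glueV P G x = G E x.
Proof.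
move=> tP PE Ex; rewrite /glueV; case: xgetP => [v _ [E' [PE' E'x ->]]|/(_ (G E x))].
  by rewrite (tP E' E) //; exists x.
by case; exists E.
Qed.

Lemma glueV_out P G x : ~ (exists2 E, P E & E x) -> glueV P G x = 0.
Proof.
by move=> no; rewrite /glueV; case: xgetP => // v _ [E [PE Ex _]]; case: no; exists E.
Qed.

Lemma L0_glueV P G : trivIset P id -> countable P ->
  (forall E, P E -> measurable E) -> (forall E, P E -> L0 (G E)) -> L0 (glueV P G).
Proof.
move=> tP cP mP mG _ Y mY; rewrite setTI.
have -> : glueV P G @^-1` Y = (\bigcup_(E in P) (E `&` (G E @^-1` Y))) `|`
    (~` (\bigcup_(E in P) E) `&` [set x | Y (0 : V)]).
  apply/seteqP; split => x /=.
    have [[E PE Ex]|no] := pselect (exists2 E, P E & E x).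
      by rewrite (glueV_in _ tP PE Ex); left; exists E.
    by rewrite (glueV_out _ no); right; split => // -[E PE Ex]; apply: no; exists E.
  move=> [[E PE [Ex Y']]|[no Y0]]; first by rewrite (glueV_in _ tP PE Ex).
  by rewrite glueV_out // => -[E PE Ex]; apply: no; exists E.
apply: measurableU.
  apply: countable_bigcup_measurable => // E PE; apply: measurableI; first exact: mP.
  by rewrite -[X in measurable X]setTI; exact: mG.
apply: measurableI; first by apply: measurableC; exact: countable_bigcup_measurable.
exact: measurable_Prop.
Qed.

End MeasurableVectors.

(** * Countable disjoint families and the class K *)

Section Countable.
Context (R : realType) (d : measure_display) (T : measurableType d)
  (mu : {sigma_finite_measure set T -> \bar R}).

(** In a set of finite measure at most finitely many disjoint sets can have
    measure at least 1/(k+1), and sigma-finiteness covers the space by countably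
    many such sets. *)
Lemma countable_disjoint (P : set (set T)) :
  trivIset P id -> (forall E, P E -> measurable E /\ (0 < mu E)%E) -> countable P.
Proof.
move=> tP mP; have [F FT mF] := sigma_finiteT mu.
pose Q i k := P `&` [set E | (k.+1%:R^-1%:E <= mu (E `&` F i))%E].
have PQ : P `<=` \bigcup_i \bigcup_k Q i k.
  move=> E PE; have [mE E0] := mP E PE; apply: contrapT => nQ.
  suff : mu E = 0%E by move=> E1; rewrite E1 ltxx in E0.
  have -> : E = \bigcup_i (E `&` F i) by rewrite -setI_bigcupr -FT setIT.
  apply/negligibleP.
    by apply: bigcupT_measurable => i; apply: measurableI => //; have [] := mF i.
  apply: negligible_bigcup => i; have mEF : measurable (E `&` F i).
    by apply: measurableI => //; have [] := mF i.
  apply/negligibleP => //; apply/eqP; rewrite eq_le measure_ge0 andbT leNgt.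
  apply/negP => p0; apply: nQ; exists i => //.
  have fin : mu (E `&` F i) \is a fin_num.
    rewrite ge0_fin_numE ?measure_ge0 //; apply: le_lt_trans (proj2 (mF i)).
    by rewrite le_measure ?inE //; have [] := mF i.
  have f0 : 0 < fine (mu (E `&` F i)) by rewrite fine_gt0 // p0 /= ltey_eq fin.
  have [k _ kH] := near_infty_natSinv_lt (PosNum f0).
  exists k => //; split => //=; rewrite -[leRHS]fineK // lee_fin ltW //.
  by apply: kH => /=.
have cQ i k : countable (Q i k).
  apply: finite_set_countable; apply: contrapT => /infiniteP /pcard_leP [g].
  have gQ m : Q i k (g m) by apply: funS.
  have [mFi Fifin] := mF i.
  have tG : trivIset setT (fun m => g m `&` F i).
    move=> a b _ _ [x [[ga _] [gb _]]].
    apply: (@inj _ _ _ g); rewrite ?inE //.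
    by apply: tP; [case: (gQ a)|case: (gQ b)|exists x].
  have mG m : measurable (g m `&` F i).
    by apply: measurableI => //; case: (gQ m) => /mP [].
  have ub N : (N%:R * k.+1%:R^-1 <= fine (mu (F i)))%R.
    rewrite -lee_fin fineK ?ge0_fin_numE ?measure_ge0 //.
    apply: (@le_trans _ _ (mu (\big[setU/set0]_(m < N) (g m `&` F i)))); last first.
      apply: le_measure; rewrite ?inE //.
        by apply: bigsetU_measurable.
      by move=> x; rewrite -(bigcup_mkord N (fun m => g m `&` F i)) => -[m _ []].
    rewrite (measure_bigsetU mu (F := fun m => g m `&` F i)) //.
    apply: (@le_trans _ _ (\sum_(m < N) (k.+1%:R^-1)%:E)%E).
      by rewrite sumEFin sumr_const card_ord lee_fin mulr_natl.
    by apply: lee_sum => m _; have [_] := gQ m.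
  have := ub (Num.truncn (fine (mu (F i)) * k.+1%:R)).+1.
  rewrite ler_pdivrMr // leNgt => /negP; apply.
  by rewrite truncnS_gt.
apply: sub_countable (subset_card_le PQ) _.
by apply: bigcup_countable => // i _; apply: bigcup_countable.
Qed.

End Countable.

Section KKfacts.
Variables (R : realType) (s : scalars) (n : nat).
Local Notation FF := (scalarF R s).
Local Notation V := 'rV[FF]_n.
Local Notation ofR := (@ofR R s).
Variable K : set V.
Hypothesis KKK : KK K.

Lemma KK_conv u v (t : R) : 0 <= t <= 1 -> K u -> K v ->
  K (ofR t *: u + ofR (1 - t) *: v).
Proof.
move=> /andP[t0 t1] Ku Kv; case: KKK => _ _ cK _.
have h0 : 0 <= ofR t by rewrite -(ofR0 R s) ofR_le.
have h1 : ofR t <= 1 by rewrite -(ofR1 R s) ofR_le.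
have := cK u v (Itv01 h0 h1); rewrite !inE => /(_ Ku Kv).
congr K; rewrite /conv /=.
by rewrite ofRD ofRN ofR1.
Qed.

Lemma KK_N u : K u -> K (- u).
Proof.
by case: KKK => _ _ _ sK Ku; rewrite -scaleN1r; apply: sK => //; rewrite normrN1.
Qed.

Lemma KK_0 : K 0.
Proof.
case: KKK => -[u Ku] _ _ _.
have h : 0 <= (2^-1 : R) <= 1 by lra.
have := KK_conv h Ku (KK_N Ku); rewrite (_ : 1 - 2^-1 = 2^-1 :> R); last by lra.
by rewrite scalerN subrr.
Qed.

End KKfacts.

Section KKbuild.
Variables (R : realType) (s : scalars) (n : nat).
Local Notation FF := (scalarF R s).
Local Notation V := 'rV[FF]_n.
Local Notation ofR := (@ofR R s).

Lemma KK_build (K : set V) : K !=set0 ->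
  (forall u, (forall e : R, 0 < e -> exists2 v, K v & l1norm (v - u) < e) -> K u) ->
  (forall u v (t : R), 0 <= t <= 1 -> K u -> K v -> K (ofR t *: u + ofR (1 - t) *: v)) ->
  (forall u (l : FF), K u -> `|l| = 1 -> K (l *: u)) -> KK K.
Proof.
move=> K0 Kc Kconv Ks; split => //; first exact/closed_l1norm.
move=> u v t; rewrite !inE => Ku Kv.
have t0 : 0 <= t%:num by [].
have t1 : t%:num <= 1 by [].
have rt : (0 : R) <= reF t%:num <= 1 by rewrite -!(ofR_le s) ofR0 ofR1 -ge0_ofR // t0 t1.
have := Kconv u v _ rt Ku Kv; congr K.
by rewrite /conv /= ofRD ofRN -ge0_ofR // ofR1.
Qed.

Lemma KK_set0 : KK ([set 0] : set V).
Proof.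
apply: KK_build; first by exists 0.
- move=> u uH; apply: l1norm_eq0; apply/eqP; rewrite eq_le l1norm_ge0 andbT leNgt.
  by apply/negP => /uH [v ->]; rewrite sub0r l1normN ltxx.
- by move=> u v t _ -> ->; rewrite /= !scaler0 addr0.
- by move=> u l -> _; rewrite /= scaler0.
Qed.

(** Only closedness is not immediate.  If u has a nonzero coordinate k, a limit v
    of points of the disc spanned by u must be (v_k / u_k) u, since the scalars of
    the approximants converge to v_k / u_k. *)
Lemma KK_Kof (u : V) : KK (Kof u).
Proof.
apply: KK_build.
- by exists (0 *: u), 0 => //=; rewrite normr0.
- move=> v vH; have [u0|/eqP u0] := pselect (u = 0).
    exists 0; rewrite /= ?normr0 // u0 scaler0.
    apply/esym/l1norm_eq0/eqP; rewrite eq_le l1norm_ge0 andbT leNgt.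
    by apply/negP => /vH [_ [l _ <-]]; rewrite u0 scaler0 sub0r l1normN ltxx.
  have [k uk] : exists k, u 0 k != 0.
    apply: contrapT => no; move/eqP: u0; apply; apply/rowP => k; rewrite mxE.
    by apply/eqP/negPn/negP => uk; apply: no; exists k.
  have a0 : 0 < absF (u 0 k) by rewrite lt_neqAle absF_ge0 eq_sym absF_eq0 uk.
  pose l0 := v 0 k / u 0 k.
  have H e : 0 < e -> absF l0 <= 1 + e / absF (u 0 k) /\
      l1norm (v - l0 *: u) <= e + 2 * (e / absF (u 0 k)) * l1norm u.
    move=> e0; have [_ [l /= l1 <-] lv] := vH _ e0.
    have dl : absF (l0 - l) <= e / absF (u 0 k).
      rewrite ler_pdivlMr // -absF_M mulrBl divfK // -absF_N opprB.
      by apply: le_trans (ltW lv); have := absF_le_l1norm (l *: u - v) k; rewrite !mxE.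
    split.
      rewrite -[l0](subrK l) addrC (le_trans (absF_D _ _)) // lerD //.
      by rewrite absF_le ofR1.
    apply: le_trans (l1norm_triangle _ (l *: u) _) _; apply: lerD; first by rewrite l1normB ltW.
    rewrite -scalerBl (le_trans (l1normZ _ _)) // ler_wpM2r ?l1norm_ge0 // ler_pM2l //.
    by rewrite -absF_N opprB.
  exists l0 => /=.
    rewrite -(ofR1 R s) -absF_le; apply/ler_addgt0Pr => e e0.
    have /H [] : 0 < e * absF (u 0 k) by rewrite mulr_gt0.
    by rewrite mulfK // gt_eqF.
  apply/eqP; rewrite eq_sym -subr_eq0; apply/eqP/l1norm_eq0/eqP.
  rewrite eq_le l1norm_ge0 andbT; apply/ler_addgt0Pr => e e0; rewrite add0r.
  pose D := 1 + 2 * (l1norm u / absF (u 0 k)).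
  have D0 : 0 < D by rewrite ltr_pwDl // mulr_ge0 // divr_ge0 ?l1norm_ge0 ?ltW.
  have /H [_ ] : 0 < e / D by rewrite divr_gt0.
  have -> // : e / D + 2 * (e / D / absF (u 0 k)) * l1norm u = e.
  apply: (@mulIf _ D); first by rewrite gt_eqF.
  by rewrite mulrDl [in RHS]/D; field; rewrite !gt_eqF.
- move=> _ _ t /andP[t0 t1] [l /= l1 <-] [m /= m1 <-].
  exists (ofR t * l + ofR (1 - t) * m); last by rewrite scalerDl !scalerA.
  rewrite /= (le_trans (ler_normD _ _)) // !normrM -!ofR_abs !absF_of.
  rewrite !ger0_norm ?subr_ge0 // -!ofRM -ofRD -(ofR1 R s) ofR_le.
  move: l1 m1; rewrite -(ofR1 R s) -!absF_le => l1 m1.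
  by have := absF_ge0 l; have := absF_ge0 m; nra.
- move=> _ l [m /= m1 <-] l1; exists (l * m); last by rewrite scalerA.
  by rewrite /= normrM l1 mul1r.
Qed.

Lemma Kof_self (u : V) : Kof u u.
Proof. by exists 1 => /=; rewrite ?normr1 ?scale1r. Qed.

Lemma Kof_sub (u v : V) : Kof v u -> Kof u `<=` Kof v.
Proof.
move=> [l /= l1 <-] _ [m /= m1 <-]; exists (m * l); last by rewrite scalerA.
by rewrite /= normrM mulr_ile1.
Qed.

End KKbuild.

(** * Selections and averages *)

Section Selections.
Context (R : realType) (s : scalars) (n : nat).
Local Notation FF := (scalarF R s).
Local Notation V := 'rV[FF]_n.
Local Notation ofR := (@ofR R s).
Context (d : measure_display) (T : measurableType d)
  (mu : {sigma_finite_measure set T -> \bar R}).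
Implicit Types (F : T -> set V) (f g : T -> V) (E : set T).

Lemma S0_zero F : (forall x, KK (F x)) -> S0 mu F (fun=> 0).
Proof.
move=> KF; split; first exact: L0_cst.
by apply: aeW => x; exact: KK_0.
Qed.

Lemma S0_conv F f g (t : R) : (forall x, KK (F x)) -> 0 <= t <= 1 ->
  S0 mu F f -> S0 mu F g -> S0 mu F (fun x => ofR t *: f x + ofR (1 - t) *: g x).
Proof.
move=> KF t01 [mf Ff] [mg Fg]; split.
  by apply: L0_D; apply: L0_Z => //; exact: measF_cst.
by apply: filterS2 Ff Fg => x; exact: KK_conv.
Qed.

Lemma S0_Z F f (l : FF) : (forall x, KK (F x)) -> `|l| = 1 ->
  S0 mu F f -> S0 mu F (fun x => l *: f x).
Proof.
move=> KF l1 [mf Ff]; split; first by apply: L0_Z => //; exact: measF_cst.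
by apply: filterS Ff => x Fx; case: (KF x) => _ _ _; exact.
Qed.

(** Decomposability: the source of the integrable majorants, of the sign changes and
    of the gluing over cells. *)
Lemma S0_piece F A f g : measurable A -> S0 mu F f -> S0 mu F g -> S0 mu F (piece A f g).
Proof.
move=> mA [mf Ff] [mg Fg]; split; first exact: L0_piece.
by apply: filterS2 Ff Fg => x; rewrite /piece; case: ifP.
Qed.

Lemma restrK_in E F x : E x -> restrK E F x = F x.
Proof. by move=> Ex; rewrite /restrK /patch mem_set. Qed.

Lemma restrK_out E F x : ~ E x -> restrK E F x = [set 0].
Proof. by move=> Ex; rewrite /restrK /patch memNset. Qed.

Lemma KK_restrK E F : (forall x, KK (F x)) -> forall x, KK (restrK E F x).
Proof.
move=> KF x; have [Ex|Ex] := pselect (E x); first by rewrite restrK_in.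
by rewrite restrK_out //; exact: KK_set0.
Qed.

Lemma restrK_sub E F x : KK (F x) -> restrK E F x `<=` F x.
Proof.
move=> KF; have [Ex|Ex] := pselect (E x); first by rewrite restrK_in.
by rewrite restrK_out // => _ ->; exact: KK_0.
Qed.

Lemma S0_restrK E F f : (forall x, KK (F x)) -> S0 mu (restrK E F) f -> S0 mu F f.
Proof.
by move=> KF [mf Ff]; split => //; apply: filterS Ff => x; exact: restrK_sub.
Qed.

Lemma S0_mask E F f : measurable E -> S0 mu F f -> S0 mu (restrK E F) (piece E f (fun=> 0)).
Proof.
move=> mE [mf Ff]; split; first by apply: L0_piece => //; exact: L0_cst.
apply: filterS Ff => x Fx; rewrite /piece; case: ifPn.
  by rewrite inE => Ex; rewrite restrK_in.
by rewrite notin_setE => Ex; rewrite restrK_out.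
Qed.

Lemma L0K_restrK E F : measurable E -> L0K F -> L0K (restrK E F).
Proof.
move=> mE [KF mF]; split; first exact: KK_restrK.
move=> U oU; have -> : [set x | restrK E F x `&` U !=set0] =
    (E `&` [set x | F x `&` U !=set0]) `|` (~` E `&` [set x | U (0 : V)]).
  apply/seteqP; split => x /=; have [Ex|Ex] := pselect (E x).
  - by rewrite restrK_in //; left.
  - by rewrite restrK_out // => -[_ [-> U0]]; right.
  - by rewrite restrK_in // => -[[]|[]].
  - by rewrite restrK_out // => -[[]|[_ U0]] //; exists 0.
apply: measurableU; first by apply: measurableI => //; exact: mF.
apply: measurableI; first exact: measurableC.
exact: measurable_Prop.
Qed.

Lemma integrableV_rcoord E f : integrableV mu E f <->
  forall i, mu.-integrable E (EFin \o (fun x => rcoord (f x) i)).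
Proof.
split => [If [k b]|If k]; first by have [] := If k; case: b.
by split; [exact: (If (k, false))|exact: (If (k, true))].
Qed.

Lemma rcoord_integralV E f i :
  rcoord (integralV mu E f) i = \int[mu]_(x in E) rcoord (f x) i.
Proof.
case: i => k b; rewrite /rcoord /= /integralV mxE /integralF.
case: b; rewrite ?reF_mk //.
rewrite /imF /mkF; move: f; case: (s) => //= f.
by rewrite /Rintegral integral0.
Qed.

Lemma rcoord_avg E f i :
  rcoord (avg mu E f) i = (fine (mu E))^-1 * \int[mu]_(x in E) rcoord (f x) i.
Proof. by rewrite /avg rcoordZ rcoord_integralV. Qed.

Lemma eq_avg E f g : (forall x, E x -> f x = g x) -> avg mu E f = avg mu E g.
Proof.
move=> fg; apply: rcoord_eq => i; rewrite !rcoord_avg; congr (_ * _).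
by apply: eq_Rintegral => x; rewrite inE => /fg ->.
Qed.

Lemma avg_comb E f g (a b : R) : measurable E ->
  integrableV mu E f -> integrableV mu E g ->
  avg mu E (fun x => ofR a *: f x + ofR b *: g x) =
  ofR a *: avg mu E f + ofR b *: avg mu E g.
Proof.
move=> mE /integrableV_rcoord If /integrableV_rcoord Ig.
apply: rcoord_eq => i; rewrite rcoordD (rcoordZ a) (rcoordZ b) !rcoord_avg.
under eq_Rintegral do rewrite rcoordD !rcoordZ.
rewrite RintegralD //; last 2 first.
- by have := integrableZl mE a (If i); under eq_fun do rewrite -EFinM.
- by have := integrableZl mE b (Ig i); under eq_fun do rewrite -EFinM.
rewrite !RintegralZl //; ring.
Qed.

Lemma avg_Z E f (l : FF) : measurable E -> integrableV mu E f ->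
  avg mu E (fun x => l *: f x) = l *: avg mu E f.
Proof.
move=> mE If; rewrite /avg scalerA mulrC -scalerA; congr (_ *: _).
apply/rowP => k; rewrite !mxE; have [Ire Iim] := If k.
have IZ (a : R) h : mu.-integrable E (EFin \o h) -> mu.-integrable E (EFin \o (fun x => a * h x)).
  by move=> /(integrableZl mE a); under eq_fun do rewrite -EFinM.
have H (h : T -> FF) : imF (integralF mu E h) = \int[mu]_(x in E) imF (h x).
  rewrite /integralF /imF /mkF; move: h; case: (s) => //= h.
  by rewrite /Rintegral integral0.
apply: FF_eq; rewrite ?reF_M ?imF_M.
- rewrite !H !reF_mk; under eq_Rintegral do rewrite mxE reF_M.
  rewrite RintegralB //; [|exact: IZ|exact: IZ].
  by rewrite !RintegralZl.
- rewrite !H reF_mk; under eq_Rintegral do rewrite mxE imF_M.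
  by rewrite RintegralD //; [rewrite !RintegralZl|exact: IZ|exact: IZ].
Qed.

End Selections.

(** * Integrable majorants *)

Lemma cvg_geometric_steps (R : realType) (a : R^nat) (K : R) :
  (forall j, `|a j.+1 - a j| <= K / 2 ^+ j) -> cvgn a.
Proof.
move=> aK; have K0 : 0 <= K.
  by have := le_trans (normr_ge0 _) (aK 0%N); rewrite expr0 divr1.
have cs : cvgn (series (telescope a)).
  apply: normed_cvg; apply: (@series_le_cvg _ _ (geometric K 2^-1)) => [j|j|j|].
  - exact: normr_ge0.
  - by rewrite /geometric /= mulr_ge0 // exprn_ge0.
  - by rewrite /geometric /= exprVn; exact: aK.
  - by apply: is_cvg_geometric_series; rewrite ger0_norm //; lra.
rewrite (_ : a = fun j => a 0%N + series (telescope a) j).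
  by apply: is_cvgD => //; exact: is_cvg_cst.
by apply/funext => j; exact: eq_sum_telescope.
Qed.

Section Dominate.
Context (R : realType) (d : measure_display) (T : measurableType d)
  (mu : {sigma_finite_measure set T -> \bar R}).

(** Monotone convergence, in the form used twice below: the limit of the sequence is
    integrable, so almost everywhere finite, and serves as the majorant. *)
Lemma dominate_incr (E : set T) (u : nat -> T -> R) (M : R) : measurable E ->
  (forall N, measurable_fun setT (u N)) -> (forall N x, 0 <= u N x) ->
  (forall N x, u N x <= u N.+1 x) ->
  (forall N, (\int[mu]_(x in E) (u N x)%:E <= M%:E)%E) ->
  exists h : T -> R, [/\ measurable_fun setT h, mu.-integrable E (EFin \o h),
    (forall x, 0 <= h x) & {ae mu, forall x, E x -> forall N, u N x <= h x}].
Proof.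
move=> mE mu_ u0 uincr uM.
have nd x : {homo (fun N => (u N x)%:E) : a b / (a <= b)%N >-> (a <= b)%E}.
  apply/nondecreasing_seqP => N; rewrite lee_fin; exact: uincr.
pose h x := limn (fun N => (u N x)%:E).
have ch x : cvgn (fun N => (u N x)%:E) by exact: ereal_nondecreasing_is_cvgn.
have uh N x : ((u N x)%:E <= h x)%E.
  by apply: lime_ge => //; exists N => // m /= Nm; exact: nd.
have h0 x : (0 <= h x)%E by apply: le_trans (uh 0%N x); rewrite lee_fin.
have mh : measurable_fun setT h.
  apply: (emeasurable_fun_cvg (fun N x => (u N x)%:E)) => [N|x _]; last exact: ch.
  exact/measurable_EFinP.
have ih : (\int[mu]_(x in E) h x <= M%:E)%E.
  rewrite /h monotone_convergence //; first last.
  - by move=> N x _; rewrite lee_fin.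
  - by move=> N; apply/measurable_EFinP; exact: measurable_funS (mu_ N).
  apply: lime_le; last by exists 0%N => // N _; exact: uM.
  apply: ereal_nondecreasing_is_cvgn => a b ab; apply: ge0_le_integral => //.
  - by move=> x _; rewrite lee_fin.
  - by apply/measurable_EFinP; exact: measurable_funS (mu_ a).
  - by apply/measurable_EFinP; exact: measurable_funS (mu_ b).
  - by move=> x _; exact: nd.
have Ih : mu.-integrable E h.
  apply/integrableP; split; first exact: measurable_funS mh.
  under eq_integral do rewrite gee0_abs //.
  by apply: le_lt_trans ih _; rewrite ltry.
have mfh : measurable_fun setT (fine \o h) by exact: measurableT_comp.
exists (fine \o h); split => //.
- apply: le_integrable Ih => //.
    by apply/measurable_EFinP; exact: measurable_funS mfh.
  by move=> x _ /=; case: (h x) => [r||] /=; rewrite ?lee_fin ?leey.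
- by move=> x /=; apply: fine_ge0.
- apply: filterS (integrable_ae mE Ih) => x hx Ex N /=.
  by rewrite -lee_fin fineK ?hx.
Qed.

End Dominate.

Section Dominator.
Context (R : realType) (s : scalars) (n : nat).
Local Notation FF := (scalarF R s).
Local Notation V := 'rV[FF]_n.
Local Notation ofR := (@ofR R s).
Context (d : measure_display) (T : measurableType d)
  (mu : {sigma_finite_measure set T -> \bar R}).
Variables (F : T -> set V) (E : set T) (M : R).
Hypothesis KF : forall x, KK (F x).
Hypothesis mE : measurable E.
Hypothesis FM : forall f, S0 mu F f ->
  integrableV mu E f /\ (\int[mu]_(x in E) (l1norm (f x))%:E <= M%:E)%E.

(** The pointwise largest of f_0, ..., f_N is a selection again, so its norm has
    integral at most M, and these norms increase with N. *)
Lemma dominate_selections (f_ : nat -> T -> V) : (forall j, S0 mu F (f_ j)) ->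
  exists h : T -> R, [/\ measurable_fun setT h, mu.-integrable E (EFin \o h),
    (forall x, 0 <= h x) & {ae mu, forall x, E x -> forall j, l1norm (f_ j x) <= h x}].
Proof.
move=> Sf.
pose A (f g : T -> V) := [set x | l1norm (f x) < l1norm (g x)].
(* phi N x is the longest of f_0 x, ..., f_N x. *)
pose phi := fix phi N := if N is N'.+1 then
  piece (A (phi N') (f_ N)) (f_ N) (phi N') else f_ 0%N.
have mA f g : L0 f -> L0 g -> measurable (A f g).
  by move=> mf mg; apply: measurable_set_lt; exact: measurable_l1norm.
have Sphi N : S0 mu F (phi N).
  elim: N => [|N IH] /=; first exact: Sf.
  apply: S0_piece => //; apply: mA; first by case: IH.
  by case: (Sf N.+1).
have phiS N x : l1norm (phi N x) <= l1norm (phi N.+1 x) /\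
    l1norm (f_ N.+1 x) <= l1norm (phi N.+1 x).
  rewrite /= /piece; case: ifPn; first by rewrite inE /A /= => /ltW.
  by rewrite notin_setE /A /= => /negP; rewrite -leNgt.
have fphi N x : l1norm (f_ N x) <= l1norm (phi N x).
  by case: N => [|N] //; have [] := phiS N x.
have [||||h [mh Ih h0 ah]] := @dominate_incr _ _ _ mu E (fun N x => l1norm (phi N x)) M mE.
- by move=> N; apply: measurable_l1norm; case: (Sphi N).
- by move=> N x; exact: l1norm_ge0.
- by move=> N x; case: (phiS N x).
- by move=> N; case: (FM (Sphi N)).
exists h; split => //; apply: filterS ah => x hx Ex j.
exact: le_trans (fphi j x) (hx Ex j).
Qed.

End Dominator.

(** * Weighted energy of nearly optimal selections *)

Section Closedness.
Context (R : realType) (s : scalars) (n : nat).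
Local Notation FF := (scalarF R s).
Local Notation V := 'rV[FF]_n.
Local Notation ofR := (@ofR R s).
Context (d : measure_display) (T : measurableType d)
  (mu : {sigma_finite_measure set T -> \bar R}).

Definition sqnorm (u : V) : R := \sum_i rcoord u i ^+ 2.

Lemma sqnorm_ge0 u : 0 <= sqnorm u. Proof. by apply: sumr_ge0 => i _; exact: sqr_ge0. Qed.

Lemma sqnorm_le_l1norm u : sqnorm u <= l1norm u ^+ 2.
Proof.
rewrite /sqnorm expr2 [X in X * _]/l1norm mulr_suml ler_sum // => i _.
by rewrite -[rcoord u i ^+ 2]ger0_norm ?sqr_ge0 // expr2 normrM ler_wpM2l ?rcoord_le_l1norm.
Qed.

Lemma rcoord_le_sqnorm u i : rcoord u i ^+ 2 <= sqnorm u.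
Proof. by rewrite /sqnorm (bigD1 i) //= lerDl sumr_ge0 // => j _; exact: sqr_ge0. Qed.

(** The midpoint is written as the convex combination for which [S0_conv] and
    [avg_comb] are stated. *)
Lemma sqnorm_parallelogram u v : sqnorm (u - v) =
  2 * sqnorm u + 2 * sqnorm v - 4 * sqnorm (ofR 2^-1 *: u + ofR (1 - 2^-1) *: v).
Proof.
rewrite /sqnorm !mulr_sumr -big_split -sumrB /=; apply: eq_bigr => i _.
by rewrite rcoordB rcoordD !rcoordZ; field.
Qed.

Lemma measurable_sqnorm (f : T -> V) : L0 f -> measurable_fun setT (fun x => sqnorm (f x)).
Proof.
by move=> /L0P mf; apply: measurable_sum => i; exact: measurable_funX.
Qed.

Lemma avg_ae (E : set T) (f g : T -> V) : measurable E -> L0 f -> L0 g ->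
  {ae mu, forall x, E x -> f x = g x} -> avg mu E f = avg mu E g.
Proof.
move=> mE /L0P mf /L0P mg fg; apply: rcoord_eq => i; rewrite !rcoord_avg; congr (_ * fine _).
apply: ae_eq_integral => //.
- by apply/measurable_EFinP; exact: measurable_funS (mf i).
- by apply/measurable_EFinP; exact: measurable_funS (mg i).
- by apply: filterS fg => x fgx Ex; rewrite fgx.
Qed.

Variables (F : T -> set V) (E : set T) (M : R).
Hypothesis KF : forall x, KK (F x).
Hypothesis mE : measurable E.
Hypothesis Efin : (mu E < +oo)%E.
Hypothesis FM : forall f, S0 mu F f ->
  integrableV mu E f /\ (\int[mu]_(x in E) (l1norm (f x))%:E <= M%:E)%E.

Section Weighted.
Variables (H : T -> R) (v : V).
Hypothesis mH : measurable_fun setT H.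
Hypothesis IH : mu.-integrable E (EFin \o H).
Hypothesis H1 : forall x, 1 <= H x.

Let H0 x : 0 < H x. Proof. exact: lt_le_trans (H1 x). Qed.

(** These sets are convex and decrease with k.  A single majorant H for all of them
    keeps the energies below finite and the later limits dominated. *)
Definition admissible (k : nat) : set (T -> V) := [set f | [/\ S0 mu F f,
  (forall x, l1norm (f x) <= H x) & l1norm (avg mu E f - v) <= k.+1%:R^-1]].

(** The weight 1/H makes the square integrable: where |f| <= H, the integrand is at
    most H. *)
Definition energy (f : T -> V) : R := \int[mu]_(x in E) (sqnorm (f x) / H x).

Lemma energy_integrable f (c : R) : L0 f -> (forall x, l1norm (f x) <= c * H x) ->
  mu.-integrable E (EFin \o (fun x => sqnorm (f x) / H x)).
Proof.
move=> mf fH.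
have IcH : mu.-integrable E (EFin \o (fun x => c ^+ 2 * H x)).
  by have := integrableZl mE (c ^+ 2) IH; under eq_fun do rewrite -EFinM.
apply: le_integrable IcH => //.
  apply/measurable_EFinP; apply: (@measurable_funS _ _ _ _ setT) => //.
  apply: measurable_funM; first exact: measurable_sqnorm.
  exact: measurable_fun_inv_gt0.
move=> x _ /=; rewrite lee_fin ger0_norm; last by rewrite divr_ge0 ?sqnorm_ge0 // ltW.
rewrite ger0_norm; last by rewrite mulr_ge0 ?sqr_ge0 // ltW.
rewrite ler_pdivrMr // -mulrA -expr2 -exprMn.
apply: le_trans (sqnorm_le_l1norm _) _.
by rewrite lerXn2r ?nnegrE ?l1norm_ge0 // (le_trans (l1norm_ge0 (f x))).
Qed.

Lemma energy_parallelogram k l f g : admissible k f -> admissible l g ->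
  energy (fun x => f x - g x) = 2 * energy f + 2 * energy g -
    4 * energy (fun x => ofR 2^-1 *: f x + ofR (1 - 2^-1) *: g x).
Proof.
move=> [[mf _] fH _] [[mg _] gH _].
have If : mu.-integrable E (EFin \o (fun x => sqnorm (f x) / H x)).
  by apply: (energy_integrable (c := 1)) => // x; rewrite mul1r.
have Ig : mu.-integrable E (EFin \o (fun x => sqnorm (g x) / H x)).
  by apply: (energy_integrable (c := 1)) => // x; rewrite mul1r.
have Im : mu.-integrable E (EFin \o
    (fun x => sqnorm (ofR 2^-1 *: f x + ofR (1 - 2^-1) *: g x) / H x)).
  apply: (energy_integrable (c := 1)) => [|x].
    by apply: L0_D; apply: L0_Z => //; exact: measF_cst.
  rewrite mul1r (le_trans (l1normD _ _)) // !l1norm_ofR !ger0_norm; [|lra|lra].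
  by have := fH x; have := gH x; lra.
have Z (a : R) h : mu.-integrable E (EFin \o h) -> mu.-integrable E (EFin \o (fun x => a * h x)).
  by move=> /(integrableZl mE a); under eq_fun do rewrite -EFinM.
rewrite /energy -!RintegralZl // -RintegralD //; [|exact: Z|exact: Z].
rewrite -RintegralB //; [| |exact: Z]; last first.
  have := integrableD mE (Z 2 _ If) (Z 2 _ Ig).
  by apply: eq_integrable => // x _.
by apply: eq_Rintegral => x _; rewrite sqnorm_parallelogram; ring.
Qed.

Lemma admissible_mid k l f g : admissible k f -> admissible l g ->
  admissible (minn k l) (fun x => ofR 2^-1 *: f x + ofR (1 - 2^-1) *: g x).
Proof.
move=> [Sf fH fv] [Sg gH gv]; split.
- by apply: S0_conv => //; lra.
- move=> x; rewrite (le_trans (l1normD _ _)) // !l1norm_ofR !ger0_norm; [|lra|lra].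
  by have := fH x; have := gH x; lra.
- have [[If _] [Ig _]] := (FM Sf, FM Sg); rewrite avg_comb //.
  have -> : ofR 2^-1 *: avg mu E f + ofR (1 - 2^-1) *: avg mu E g - v =
      ofR 2^-1 *: (avg mu E f - v) + ofR (1 - 2^-1) *: (avg mu E g - v).
    move: (avg mu E f) (avg mu E g) => a b.
    by apply: rcoord_eq => i; rewrite !(rcoordB, rcoordD, rcoordZ); field.
  rewrite (le_trans (l1normD _ _)) // !l1norm_ofR !ger0_norm; [|lra|lra].
  have : k.+1%:R^-1 <= (minn k l).+1%:R^-1 :> R.
    by rewrite lef_pV2 ?posrE // ler_nat ltnS geq_minl.
  have : l.+1%:R^-1 <= (minn k l).+1%:R^-1 :> R.
    by rewrite lef_pV2 ?posrE // ler_nat ltnS geq_minr.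
  move: fv gv; set a := l1norm _; set b := l1norm (_ - _).
  move: (k.+1%:R^-1 : R) (l.+1%:R^-1 : R) ((minn k l).+1%:R^-1 : R) => c e t.
  by lra.
Qed.

Lemma admissible_le k l : (k <= l)%N -> admissible l `<=` admissible k.
Proof.
move=> kl f [Sf fH fv]; split => //; apply: le_trans fv _.
by rewrite lef_pV2 ?posrE // ler_nat ltnS.
Qed.

Lemma energy_ge0 f : 0 <= energy f.
Proof. by apply: Rintegral_ge0 => x _; rewrite divr_ge0 ?sqnorm_ge0 // ltW. Qed.

Lemma energy_le k f : admissible k f -> energy f <= \int[mu]_(x in E) H x.
Proof.
move=> [[mf _] fH _]; apply: le_Rintegral => //.
  by apply: (energy_integrable (c := 1)) => // x; rewrite mul1r.
move=> x _; rewrite ler_pdivrMr // -expr2 (le_trans (sqnorm_le_l1norm _)) //.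
by rewrite lerXn2r ?nnegrE ?l1norm_ge0 // ltW.
Qed.

(** Let m be the supremum over k of the infimum of the energy over [admissible k].
    Far enough in the sequence of these sets all infima exceed m - 16^-j, so that
    the midpoint of two members with energy below m + 16^-j and m + 16^-(j+1) still
    has energy at least m - 16^-j.  The parallelogram identity then bounds the
    energy of the difference by 4 (m + 16^-j) - 4 (m - 16^-j). *)
Lemma minimizing_sequence : (forall k, admissible k !=set0) ->
  exists g : nat -> T -> V, (forall j, admissible j (g j)) /\
    forall j, energy (fun x => g j x - g j.+1 x) <= 8 / 16 ^+ j.
Proof.
move=> ne; pose mk k := inf [set energy f | f in admissible k].
have hi k : has_inf [set energy f | f in admissible k].
  split; first by have [f fk] := ne k; exists (energy f), f.
  by exists 0 => _ [f _ <-]; exact: energy_ge0.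
have mk_le k f : admissible k f -> mk k <= energy f.
  by move=> fk; apply: ge_inf; [case: (hi k)|exists f].
have mk_mono k l : (k <= l)%N -> mk k <= mk l.
  move=> kl; apply: lb_le_inf; first by case: (hi l).
  by move=> _ [f fl <-]; apply: mk_le; exact: admissible_le fl.
have hs : has_sup (range mk).
  split; first by exists (mk 0%N), 0%N.
  exists (\int[mu]_(x in E) H x) => _ [k _ <-].
  by have [f fk] := ne k; apply: le_trans (mk_le _ _ fk) (energy_le fk).
pose m := sup (range mk).
have mkm k : mk k <= m by apply: ub_le_sup; [case: hs|exists k].
have eps0 j : 0 < (16 ^+ j)^-1 :> R by rewrite invr_gt0 exprn_gt0.
have step j : exists p : nat * (T -> V), [/\ (j <= p.1)%N,
    m - (16 ^+ j)^-1 < mk p.1, admissible p.1 p.2 & energy p.2 < m + (16 ^+ j)^-1].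
  have [_ [k0 _ <-] k0m] := sup_adherent (eps0 j) hs.
  have [_ [f fk <-] fm] := inf_adherent (eps0 j) (hi (maxn j k0)).
  exists (maxn j k0, f); split => //=; first exact: leq_maxl.
    by apply: lt_le_trans k0m _; apply: mk_mono; exact: leq_maxr.
  by apply: lt_le_trans fm _; rewrite lerD2r; exact: mkm.
have [p pP] := choice step.
exists (fun j => (p j).2); split => j.
  by have [jp _ pk _] := pP j; exact: admissible_le pk.
have [_ m1 n1 e1] := pP j; have [_ m2 n2 e2] := pP j.+1.
rewrite (energy_parallelogram n1 n2).
have := mk_le _ _ (admissible_mid n1 n2).
have d12 : (16 ^+ j.+1)^-1 <= (16 ^+ j)^-1 :> R.
  by rewrite lef_pV2 ?posrE ?exprn_gt0 // exprS ler_peMl ?exprn_ge0 //; lra.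
have : m - (16 ^+ j)^-1 <= mk (minn (p j).1 (p j.+1).1).
  case: leqP => _; first exact: (ltW m1).
  by apply: le_trans (ltW m2); rewrite lerD2l lerN2.
move: e1 e2 d12; set a := (16 ^+ j)^-1; set b := (16 ^+ j.+1)^-1.
by lra.
Qed.

End Weighted.
End Closedness.

(** * Closedness of the set of averages *)

Section Attained.
Context (R : realType) (s : scalars) (n : nat).
Local Notation FF := (scalarF R s).
Local Notation V := 'rV[FF]_n.
Local Notation ofR := (@ofR R s).
Context (d : measure_display) (T : measurableType d)
  (mu : {sigma_finite_measure set T -> \bar R}).

Lemma cvg_l1norm (a : nat -> V) (b : V) :
  (forall i, (fun j => rcoord (a j) i) @ \oo --> rcoord b i) ->
  (fun j => l1norm (a j - b)) @ \oo --> (0 : R).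
Proof.
move=> ab; rewrite /l1norm.
elim: (index_enum _) => [|i r IH].
  by under eq_fun do rewrite big_nil; exact: cvg_cst.
under eq_fun do rewrite big_cons.
rewrite -[X in nbhs X](addr0 (0 : R)); apply: cvgD => //.
rewrite -(normr0 R); apply: cvg_norm.
under eq_fun do rewrite rcoordB.
by rewrite -(subrr (rcoord b i)); apply: cvgB => //; exact: cvg_cst.
Qed.

Lemma KK_closed_cvg (K : set V) (a : nat -> V) (b : V) : KK K ->
  (forall j, K (a j)) -> (forall i, (fun j => rcoord (a j) i) @ \oo --> rcoord b i) -> K b.
Proof.
move=> [_ /closed_l1norm cK _ _] Ka /cvg_l1norm ab; apply: cK => e e0.
have /cvgrPdist_lt /(_ e e0) [N _ NH] := ab.
exists (a N) => //; have := NH N (leqnn N).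
by rewrite /= sub0r normrN ger0_norm // l1norm_ge0.
Qed.

(** The upper limit depends measurably on x and is the limit wherever the sequence
    converges. *)
Definition limV (g : nat -> T -> V) (x : T) : V :=
  of_rcoord s (fun i => fine (limn_esup (fun j => (rcoord (g j x) i)%:E))).

Lemma L0_limV g : (forall j, L0 (g j)) -> L0 (limV g).
Proof.
move=> mg; apply/L0P => i; under eq_fun do rewrite rcoord_of_rcoord.
apply: measurable_funM => //.
apply: measurableT_comp => //; apply: measurable_fun_limn_esup => j.
by apply/measurable_EFinP; move/L0P : (mg j).
Qed.

Lemma limV_cvg g x : (forall i, cvgn (fun j => rcoord (g j x) i)) ->
  forall i, (fun j => rcoord (g j x) i) @ \oo --> rcoord (limV g x) i.
Proof.
move=> cg i; have /cvg_ex [l al] := cg i.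
have el : limn_esup (fun j => (rcoord (g j x) i)%:E) = l%:E.
  by apply: (cvg_limn_einf_sup _).2; apply: cvg_EFin => //; exact: nearW.
rewrite rcoord_of_rcoord el /=; under eq_fun do rewrite -coord_weight_rcoord.
by apply: cvgM => //; exact: cvg_cst.
Qed.

Variables (F : T -> set V) (E : set T) (M : R).
Hypothesis KF : forall x, KK (F x).
Hypothesis mE : measurable E.
Hypothesis Efin : (mu E < +oo)%E.
Hypothesis FM : forall f, S0 mu F f ->
  integrableV mu E f /\ (\int[mu]_(x in E) (l1norm (f x))%:E <= M%:E)%E.

Section Limit.
Variables (H : T -> R) (v : V) (g : nat -> T -> V).
Hypothesis mH : measurable_fun setT H.
Hypothesis IH : mu.-integrable E (EFin \o H).
Hypothesis H1 : forall x, 1 <= H x.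
Hypothesis gN : forall j, admissible mu F E H v j (g j).
Hypothesis gJ : forall j, energy mu E H (fun x => g j x - g j.+1 x) <= 8 / 16 ^+ j.

Let H0 x : 0 < H x. Proof. exact: lt_le_trans (H1 x). Qed.
Let mg j : L0 (g j). Proof. by case: (gN j) => -[]. Qed.

(** The energies of the steps are at most 8 / 16^j, so the integrands multiplied by 4^j
    have an integrable sum, which is finite almost everywhere. *)
Lemma steps_bound : exists h : T -> R,
  {ae mu, forall x, E x -> forall j, sqnorm (g j x - g j.+1 x) <= h x / 4 ^+ j}.
Proof.
pose r j x := sqnorm (g j x - g j.+1 x) / H x.
pose u N x := \sum_(j < N) 4 ^+ j * r j x.
have r0 j x : 0 <= r j x by rewrite divr_ge0 ?sqnorm_ge0 // ltW.
have md j : L0 (fun x => g j x - g j.+1 x).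
  under eq_fun do rewrite -scaleN1r.
  by apply: L0_D => //; apply: L0_Z => //; exact: measF_cst.
have Ir j : mu.-integrable E (EFin \o r j).
  apply: (energy_integrable mE mH IH H1 (c := 2)) => // x.
  have [_ gH _] := gN j; have [_ gH' _] := gN j.+1.
  by rewrite (le_trans (l1normD _ _)) // l1normN; have := gH x; have := gH' x; lra.
(* 16 - 16 / 4^N increases by 12 / 4^N, and the N-th term is at most 8 / 4^N. *)
have Iu N : mu.-integrable E (EFin \o u N) /\
    \int[mu]_(x in E) u N x <= 16 - 16 / 4 ^+ N.
  elim: N => [|N [IuN uN]].
    rewrite /u; split.
      by under eq_fun do rewrite big_ord0; exact: integrable0.
    under eq_Rintegral do rewrite big_ord0.
    by rewrite /Rintegral integral0 expr0 divr1 subrr.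
  have I4 : mu.-integrable E (EFin \o (fun x => 4 ^+ N * r N x)).
    by have := integrableZl mE (4 ^+ N) (Ir N); under eq_fun do rewrite -EFinM.
  split.
    by have := integrableD mE IuN I4; apply: eq_integrable => // x _; rewrite /u /= big_ord_recr.
  under eq_Rintegral do rewrite /u big_ord_recr /=.
  rewrite RintegralD // RintegralZl //.
  have p0 : 0 < (4 ^+ N)^-1 :> R by rewrite invr_gt0 exprn_gt0.
  have rN : \int[mu]_(x in E) r N x <= 8 * ((4 ^+ N)^-1 * (4 ^+ N)^-1).
    by rewrite -invfM -exprMn -natrM; exact: gJ.
  have : 4 ^+ N * \int[mu]_(x in E) r N x <= 8 * (4 ^+ N)^-1.
    rewrite -(@ler_pM2l _ (4 ^+ N)^-1) // mulrA mulVf ?mul1r; last by rewrite expf_neq0.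
    by rewrite mulrCA.
  rewrite exprS invfM; move: uN p0; rewrite /u; set p := (4 ^+ N)^-1.
  by lra.
have [||||h [_ _ h0 uh]] := @dominate_incr _ _ _ mu E u 16 mE.
- move=> N; apply: measurable_sum => j; apply: measurable_funM => //.
  apply: measurable_funM; first exact: measurable_sqnorm.
  exact: measurable_fun_inv_gt0.
- by move=> N x; apply: sumr_ge0 => j _; rewrite mulr_ge0.
- by move=> N x; rewrite /u big_ord_recr /= lerDl mulr_ge0.
- move=> N; have [IuN uN] := Iu N.
  rewrite -[leLHS]fineK; last exact: integrable_fin_num.
  rewrite lee_fin (le_trans uN) // gerBl divr_ge0 //.
exists (fun x => h x * H x); apply: filterS uh => x hx Ex j.
have := hx Ex j.+1; rewrite /u big_ord_recr /= => uj.
have : 4 ^+ j * r j x <= h x.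
  apply: le_trans uj; rewrite lerDr; apply: sumr_ge0 => k _; by rewrite mulr_ge0.
by rewrite /r mulrA ler_pdivrMr // ler_pdivlMr ?exprn_gt0 // [4 ^+ j * _]mulrC.
Qed.

(** By [steps_bound] consecutive terms differ by a multiple of 2^-j at almost every
    point of E, so the sequence converges there; the limit is in F x because F x is
    closed, and its average is v by dominated convergence. *)
Lemma limit_attains : exists2 f, S0 mu F f & avg mu E f = v.
Proof.
have [h hq] := steps_bound.
have cv : {ae mu, forall x, E x -> forall i,
    (fun j => rcoord (g j x) i) @ \oo --> rcoord (limV g x) i}.
  apply: filterS hq => x hx Ex; apply: limV_cvg => i.
  apply: (@cvg_geometric_steps _ _ (1 + h x)) => j.
  have hj := hx Ex j; have rq := rcoord_le_sqnorm (g j x - g j.+1 x) i.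
  have h0 : 0 <= h x.
    by have := le_trans (sqnorm_ge0 _) hj; rewrite pmulr_lge0 // invr_gt0 exprn_gt0.
  rewrite distrC -rcoordB -ler_sqr ?nnegrE ?divr_ge0 ?exprn_ge0 ?addr_ge0 //.
  rewrite real_normK ?num_real // (le_trans rq) // (le_trans hj) //.
  rewrite expr_div_n -exprM mulnC exprM (_ : 2 ^+ 2 = 4 :> R); last by rewrite -natrX.
  rewrite ler_pM2r ?invr_gt0 ?exprn_gt0 //; nra.
have Fg : {ae mu, forall x, forall j, F x (g j x)}.
  by apply: ae_foralln => j; case: (gN j) => -[].
pose f := piece E (limV g) (fun=> 0).
have mf : L0 f by apply: L0_piece => //; [exact: L0_limV|exact: L0_cst].
have fE x : E x -> f x = limV g x by move=> Ex; rewrite /f /piece mem_set.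
exists f.
  split => //; apply: filterS2 cv Fg => x cx Fx.
  have [Ex|Ex] := pselect (E x); last by rewrite /f /piece memNset //; exact: KK_0.
  by rewrite fE //; apply: (KK_closed_cvg (KF x) Fx); exact: cx.
apply: rcoord_eq => i; rewrite rcoord_avg.
have mgi j : measurable_fun E (EFin \o (fun x => rcoord (g j x) i)).
  by apply/measurable_EFinP; move/L0P: (mg j) => /(_ i); exact: measurable_funS.
have [|||If _ ] := @dominated_convergence _ _ _ mu E mE
    (fun j => EFin \o (fun x => rcoord (g j x) i)) (EFin \o (fun x => rcoord (f x) i))
    (EFin \o H) mgi _ _ IH.
- by apply/measurable_EFinP; move/L0P: mf => /(_ i); exact: measurable_funS.
- apply: filterS cv => x cx Ex; rewrite /= fE //.
  by apply: cvg_EFin; [exact: nearW|exact: cx].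
- apply: aeW => x j _ /=; rewrite lee_fin; have [_ gH _] := gN j.
  exact: le_trans (rcoord_le_l1norm _ _) (gH x).
move=> dc.
have c1 : (fun j => rcoord (avg mu E (g j)) i) @ \oo -->
    (fine (mu E))^-1 * \int[mu]_(x in E) rcoord (f x) i.
  under eq_fun do rewrite rcoord_avg.
  apply: cvgM; first exact: cvg_cst.
  apply: fine_cvg; rewrite fineK //.
  exact: integrable_fin_num.
have c2 : (fun j => rcoord (avg mu E (g j)) i) @ \oo --> rcoord v i.
  apply/cvgrPdist_lt => e e0; have := near_infty_natSinv_lt (PosNum e0).
  apply: filterS => j /= je; rewrite distrC -rcoordB.
  apply: le_lt_trans (rcoord_le_l1norm _ _) _; have [_ _ gv] := gN j.
  exact: le_lt_trans gv je.
exact: (cvg_unique _ c1 c2).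
Qed.

End Limit.

(** The given selections are set to 0 where they exceed the majorant; this happens on
    a null set, and then they are admissible. *)
Lemma avg_attained (v : V) :
  (forall e : R, 0 < e -> exists2 f, S0 mu F f & l1norm (avg mu E f - v) < e) ->
  exists2 f, S0 mu F f & avg mu E f = v.
Proof.
move=> vH.
have /choice [f0 f0P] : forall j : nat, exists f, S0 mu F f /\ l1norm (avg mu E f - v) < j.+1%:R^-1.
  by move=> j; have [|f Sf fv] := vH (j.+1%:R^-1); [rewrite invr_gt0|exists f].
have [|h [mh Ih h0 hf]] := dominate_selections mE FM (f_ := f0).
  by move=> j; case: (f0P j).
pose H x := 1 + h x.
have mH : measurable_fun setT H by exact: measurable_funD.
have H1 x : 1 <= H x by rewrite lerDl.
have IH : mu.-integrable E (EFin \o H).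
  have I1 : mu.-integrable E (cst 1%E).
    apply/integrableP; split; first exact: measurable_cst.
    under eq_integral do rewrite gee0_abs ?lee01 //.
    by rewrite integral_cst // mul1e.
  by have := integrableD mE I1 Ih; apply: eq_integrable => // x _.
pose A j := [set x | l1norm (f0 j x) <= H x].
have mf0 j : L0 (f0 j) by case: (f0P j) => -[].
have mA j : measurable (A j).
  by apply: measurable_set_le => //; exact: measurable_l1norm.
pose f j := piece (A j) (f0 j) (fun=> 0).
have Sf j : S0 mu F (f j).
  by apply: S0_piece => //; [case: (f0P j)|exact: S0_zero].
have [|g [gN gJ]] := minimizing_sequence (v := v) KF mE FM mH IH H1.
  move=> k; exists (f k); split => //.
    move=> x; rewrite /f /piece; case: ifPn; first by rewrite inE.
    by rewrite l1norm0 (le_trans ler01).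
  rewrite (_ : avg mu E (f k) = avg mu E (f0 k)); first by case: (f0P k) => _ /ltW.
  apply: avg_ae => //; first by case: (Sf k).
  apply: filterS hf => x hx Ex; rewrite /f /piece mem_set //= /A /=.
  by apply: le_trans (hx Ex k) _; rewrite /H lerDr.
exact: limit_attains gN gJ.
Qed.

End Attained.

(** * Bounded families in F^n have a well-conditioned spanning set *)

(** The recursion is the bound produced by one elimination step of [near_basis]. *)
Fixpoint basis_const (R : realType) (m : nat) : R :=
  if m is m'.+1 then 2 + 2 * (m'%:R * basis_const R m') + basis_const R m' else 0.

Lemma basis_const_ge0 (R : realType) m : 0 <= basis_const R m.
Proof. by elim: m => //= m IH; rewrite !addr_ge0 // mulr_ge0 // mulr_ge0. Qed.

Section NearBasis.
Variables (R : realType) (s : scalars) (n : nat).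
Local Notation FF := (scalarF R s).
Local Notation V := 'rV[FF]_n.
Local Notation ofR := (@ofR R s).

Lemma absF_sum (J : Type) (r : seq J) (f : J -> FF) :
  absF (\sum_(j <- r) f j) <= \sum_(j <- r) absF (f j).
Proof.
elim: r => [|j r IH]; first by rewrite !big_nil absF_0.
by rewrite !big_cons (le_trans (absF_D _ _)) // lerD2l.
Qed.

Definition coef (u : V) (l : 'cV[FF]_n) : FF := (u *m l) 0 0.

(** Gaussian elimination with a nearly maximal pivot.  Choose a member a(i2) whose
    last possibly nonzero coordinate is at least half of the supremum over the
    family, and subtract from each a(i) the multiple of a(i2) that cancels this
    coordinate: its factor is at most 2 and linear in a(i).  The induction
    hypothesis spans the remainders by m of them, which are the members of the
    family at these indices up to multiples of a(i2). *)
Lemma near_basis m (I : Type) (i0 : I) (a : I -> V) (B : R) :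
  (forall i k, absF (a i 0 k) <= B) ->
  (forall i (k : 'I_n), (m <= k)%N -> a i 0 k = 0) ->
  exists (p : nat -> I) (l : nat -> 'cV[FF]_n), forall i,
    a i = \sum_(j < m) coef (a i) (l j) *: a (p j) /\
    forall j, (j < m)%N -> absF (coef (a i) (l j)) <= basis_const R m.
Proof.
elim: m a B => [|m IH] a B aB az.
  exists (fun=> i0), (fun=> 0) => i; split => //.
  by rewrite big_ord0; apply/rowP => k; rewrite az // mxE.
have Cm := basis_const_ge0 R m.
have Cs : basis_const R m <= basis_const R m.+1.
  by rewrite /= lerDr addr_ge0 // mulr_ge0 // mulr_ge0.
have [[k [km [i1 ai1]]]|no] := pselect
  (exists k : 'I_n, k = m :> nat /\ exists i, a i 0 k != 0); last first.
  have az' i (k : 'I_n) : (m <= k)%N -> a i 0 k = 0.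
    rewrite leq_eqVlt => /orP[/eqP mk|]; last exact: az.
    by apply/eqP/negPn/negP => aik; apply: no; exists k; split => //; exists i.
  have [p [l pl]] := IH a B aB az'.
  exists p, (fun j => if (j < m)%N then l j else 0) => i; have [ai lb] := pl i; split.
    rewrite big_ord_recr /= ltnn /coef mulmx0 mxE scale0r addr0 [LHS]ai.
    by apply: eq_bigr => j _; rewrite ltn_ord.
  move=> j _; case: ifP => jm; first exact: le_trans (lb j jm) Cs.
  by rewrite /coef mulmx0 mxE absF_0 (le_trans Cm).
pose S := [set absF (a i 0 k) | i in setT].
have hS : has_sup S.
  by split; [exists (absF (a i1 0 k)), i1|exists B => _ [i _ <-]].
have S0 : 0 < sup S.
  apply: (@lt_le_trans _ _ (absF (a i1 0 k))).
    by rewrite lt_neqAle absF_ge0 eq_sym absF_eq0 ai1.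
  by apply: ub_le_sup; [case: hS|exists i1].
have S2 : 0 < sup S / 2 by rewrite divr_gt0.
have [_ [i2 _ <-] i2S] := sup_adherent S2 hS.
have a20 : 0 < absF (a i2 0 k) by apply: lt_trans i2S; lra.
have an0 : a i2 0 k != 0 by rewrite -absF_eq0 gt_eqF.
pose r i := a i 0 k / a i2 0 k.
have r2 i : absF (r i) <= 2.
  rewrite /r absF_M absF_V ler_pdivrMr //.
  have : absF (a i 0 k) <= sup S by apply: ub_le_sup; [case: hS|exists i].
  by lra.
pose b i := a i - r i *: a i2.
pose rl : 'cV[FF]_n := (a i2 0 k)^-1 *: delta_mx k 0.
have rlE i : coef (a i) rl = r i.
  by rewrite /coef /rl -scalemxAr -colE !mxE mulrC.
(* Right multiplication by N is the elimination a i |-> b i. *)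
pose N : 'M[FF]_n := 1%:M - rl *m a i2.
have bN i : b i = a i *m N.
  rewrite /N mulmxBr mulmx1 mulmxA; congr (_ - _).
  by rewrite [a i *m rl]mx11_scalar mul_scalar_mx -rlE.
have bB i j : absF (b i 0 j) <= B + 2 * B.
  rewrite !mxE (le_trans (absF_D _ _)) // absF_N absF_M lerD //.
  by rewrite ler_pM ?absF_ge0.
have bz i (j : 'I_n) : (m <= j)%N -> b i 0 j = 0.
  rewrite leq_eqVlt => /orP[/eqP mj|mj].
    have -> : j = k by apply: val_inj; rewrite /= km.
    by rewrite !mxE /r divfK // subrr.
  by rewrite !mxE !az // mulr0 subr0.
have [p [l pl]] := IH b _ bB bz.
pose l1 j := N *m l j.
have l1E i j : coef (a i) (l1 j) = coef (b i) (l j).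
  by rewrite /coef /l1 mulmxA -bN.
(* Substituting b = a - r a(i2) in the expansion of b i, the multiples of a(i2) add up
   to this coefficient. *)
pose lm := rl - \sum_(j < m) r (p j) *: l1 j.
have lmE i : coef (a i) lm = r i - \sum_(j < m) r (p j) * coef (b i) (l j).
  rewrite {1}/coef /lm mulmxBr mulmx_sumr mxE -rlE; congr (_ + _).
  rewrite mxE summxE; congr (- _); apply: eq_bigr => j _.
  by rewrite -l1E -scalemxAr mxE.
exists (fun j => if (j < m)%N then p j else i2), (fun j => if (j < m)%N then l1 j else lm) => i.
have [bi lb] := pl i; split.
  rewrite big_ord_recr /= ltnn lmE.
  under eq_bigr do rewrite ltn_ord l1E.
  rewrite scalerBl scaler_suml addrCA -sumrB.
  have -> : \sum_(j < m) (coef (b i) (l j) *: a (p j) -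
      (r (p j) * coef (b i) (l j)) *: a i2) = b i.
    rewrite [RHS]bi; apply: eq_bigr => j _.
    by rewrite /b scalerBr scalerA [r _ * _]mulrC.
  by rewrite /b addrC subrK.
move=> j _; case: ifP => jm; first by rewrite l1E (le_trans (lb j jm)).
rewrite lmE (le_trans (absF_D _ _)) // absF_N /= -addrA lerD //.
rewrite (le_trans (absF_sum _ _)) // (@le_trans _ _ (\sum_(j < m) 2 * basis_const R m)) //.
  apply: ler_sum => j' _; rewrite absF_M ler_pM ?absF_ge0 //; exact: lb.
by rewrite sumr_const card_ord -[leLHS]mulr_natl mulrCA lerDl.
Qed.

End NearBasis.

(** * Norms on subspaces of F^n *)

Section NormBound.
Variables (R : realType) (s : scalars) (n : nat).
Local Notation FF := (scalarF R s).
Local Notation V := 'rV[FF]_n.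
Local Notation ofR := (@ofR R s).

(** Bolzano-Weierstrass, transported from the real coordinates. *)
Lemma bounded_cluster (u : nat -> V) (B : R) : (forall k, l1norm (u k) <= B) ->
  exists z : V, forall (e : R) K, 0 < e -> exists2 k, (K <= k)%N & l1norm (u k - z) < e.
Proof.
move=> uB; pose I := ('I_n * bool)%type.
pose w k : 'rV[R]_#|{: I}| := \row_j rcoord (u k) (enum_val j).
have cpt := @rV_compact R #|{: I}| (fun=> `[- B, B]%classic) (fun=> @segment_compact _ _ _).
have [|a [_ acl]] := cpt (w @ \oo) _.
  exists 0%N => // k _ j /=; rewrite in_itv /= mxE -ler_norml.
  exact: le_trans (rcoord_le_l1norm _ _) (uB k).
pose z := of_rcoord s (fun i => a ord0 (enum_rank i)).
exists z => e K e0; pose e1 := e / (#|{: I}|%:R + 1).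
have N0 : (0 : R) < #|{: I}|%:R + 1 by rewrite ltr_wpDl.
have e10 : 0 < e1 by rewrite divr_gt0.
have [||_ [[k Kk <-] [_ ak]]] := acl [set w k | k in [set k | (K <= k)%N]] (ball a e1).
- by exists K => // k Kk; exists k.
- exact: nbhsx_ballx.
exists k => //; rewrite /l1norm.
apply: sum_lt_card => // i; have := ak ord0 (enum_rank i).
rewrite /w /ball /= mxE enum_rankK rcoordB /z rcoord_of_rcoord => /ltW; apply: le_trans.
have /andP[s0 s1] := coord_weight01 R s i.
rewrite -[rcoord (u k) i]coord_weight_rcoord -mulrBr normrM ger0_norm // distrC.
by rewrite coord_weight_rcoord ler_piMl.
Qed.

Variables (W : set V) (N : V -> R).
Hypothesis W0 : W 0.
Hypothesis WD : forall u v, W u -> W v -> W (u + v).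
Hypothesis WZ : forall (l : FF) u, W u -> W (l *: u).
Hypothesis N_ge0 : forall u, W u -> 0 <= N u.
Hypothesis ND : forall u v, W u -> W v -> N (u + v) <= N u + N v.
Hypothesis NZ : forall (l : FF) u, W u -> N (l *: u) = absF l * N u.
Hypothesis N_eq0 : forall u, W u -> N u = 0 -> u = 0.

(** All norms on a subspace W of F^n are equivalent.  By [near_basis] applied to the
    l1 unit ball of W, there is a linear map pi from F^n into W, the identity on W,
    which is continuous; therefore W is closed, and N is at most a multiple D of the
    l1 norm.  If the converse bound failed, unit vectors u_k of W with N u_k tending
    to 0 would cluster at a vector z of W with N z = 0; so z = 0, although z is
    approximated by unit vectors. *)
Lemma norm_bound : exists B : R, forall u, W u -> l1norm u <= B * N u.
Proof.
pose I := {u : V | W u /\ l1norm u <= 1}.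
have W01 : W 0 /\ l1norm (0 : V) <= 1 by rewrite l1norm0.
have [||p [l pl]] := @near_basis R s n n I (exist _ 0 W01) (fun i => sval i) 1.
- by move=> [u [Wu u1]] k /=; exact: le_trans (absF_le_l1norm u k) u1.
- by move=> i k nk; have := ltn_ord k; rewrite ltnNge nk.
pose a (j : 'I_n) := sval (p j).
have Wa j : W (a j) by rewrite /a; case: (p j) => u [].
pose pi (v : V) := \sum_(j < n) coef v (l j) *: a j.
have Wsum (c : 'I_n -> FF) : W (\sum_(j < n) c j *: a j).
  by elim/big_ind: _ => // j _; exact: WZ.
pose C := basis_const R n; have C0 : 0 <= C := basis_const_ge0 R n.
have N0 : N 0 = 0 by rewrite -(scale0r 0) NZ // absF_0 mul0r.
have scl u : W u -> l1norm u != 0 ->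
    W (ofR (l1norm u)^-1 *: u) /\ l1norm (ofR (l1norm u)^-1 *: u) = 1.
  move=> Wu u0; split; first exact: WZ.
  by rewrite l1norm_ofR ger0_norm ?invr_ge0 ?l1norm_ge0 // mulVf.
have piE u : W u -> u = pi u.
  move=> Wu; have [u0|u0] := eqVneq (l1norm u) 0.
    by rewrite (l1norm_eq0 u0) /pi big1 // => j _; rewrite /coef mul0mx mxE scale0r.
  have [Wu' l1norm'] := scl u Wu u0.
  have H : W (ofR (l1norm u)^-1 *: u) /\ l1norm (ofR (l1norm u)^-1 *: u) <= 1 by rewrite l1norm'.
  have [/= e _] := pl (exist _ _ H).
  have := congr1 (fun v => ofR (l1norm u) *: v) e.
  rewrite /= scalerA -ofRM divff // ofR1 scale1r => eu.
  rewrite [LHS]eu.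
  rewrite scaler_sumr; apply: eq_bigr => j _.
  by rewrite /coef -scalemxAl mxE scalerA mulrA -ofRM divff // ofR1 mul1r.
pose D := \sum_(j < n) C * N (a j).
have Nub u : W u -> N u <= D * l1norm u.
  move=> Wu; have [u0|u0] := eqVneq (l1norm u) 0.
    by rewrite (l1norm_eq0 u0) N0 l1norm0 mulr0.
  have [Wu' l1norm'] := scl u Wu u0.
  have H : W (ofR (l1norm u)^-1 *: u) /\ l1norm (ofR (l1norm u)^-1 *: u) <= 1 by rewrite l1norm'.
  have [/= e lb] := pl (exist _ _ H).
  suff : N (ofR (l1norm u)^-1 *: u) <= D.
    rewrite NZ // absF_of ger0_norm ?invr_ge0 ?l1norm_ge0 //.
    by rewrite mulrC ler_pdivrMr // lt_neqAle l1norm_ge0 eq_sym u0.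
  rewrite [X in N X]e.
  have Nsum (c : 'I_n -> FF) : N (\sum_(j < n) c j *: a j) <= \sum_(j < n) absF (c j) * N (a j).
    suff : W (\sum_(j < n) c j *: a j) /\
      N (\sum_(j < n) c j *: a j) <= \sum_(j < n) absF (c j) * N (a j) by case.
    elim/big_ind2: _ => [|v x w y [Wv vx] [Ww wy]|j _]; first by rewrite N0.
      by split; [exact: WD|rewrite (le_trans (ND Wv Ww)) // lerD].
    by split; [exact: WZ|rewrite NZ].
  apply: le_trans (Nsum _) _; apply: ler_sum => j _.
  by apply: ler_wpM2r; [exact: N_ge0|exact: lb].
have D0 : 0 <= D by apply: sumr_ge0 => j _; rewrite mulr_ge0 // N_ge0.
have coefn v (k : 'cV[FF]_n) : absF (coef v k) <= (\sum_j absF (k j 0)) * l1norm v.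
  rewrite /coef mxE (le_trans (absF_sum _ _)) // mulr_suml ler_sum // => j _.
  by rewrite absF_M mulrC ler_wpM2l ?absF_ge0 ?absF_le_l1norm.
pose D' := \sum_(j < n) 2 * (\sum_k absF (l j k 0)) * l1norm (a j).
have D'0 : 0 <= D'.
  by apply: sumr_ge0 => j _; rewrite !mulr_ge0 ?l1norm_ge0 // sumr_ge0 // => k _; exact: absF_ge0.
have pib v : l1norm (pi v) <= D' * l1norm v.
  have nsum (f : 'I_n -> V) : l1norm (\sum_(j < n) f j) <= \sum_(j < n) l1norm (f j).
    elim/big_ind2: _ => [|v' x w y vx wy|//]; first by rewrite l1norm0.
    by rewrite (le_trans (l1normD _ _)) // lerD.
  rewrite (le_trans (nsum _)) // mulr_suml ler_sum // => j _.
  rewrite (le_trans (l1normZ _ _)) // -!mulrA ler_pM2l // [leRHS]mulrCA [leLHS]mulrC.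
  by rewrite ler_wpM2l ?l1norm_ge0.
apply: contrapT => nB.
have /choice [u uP] : forall k : nat, exists u, [/\ W u, l1norm u = 1 & N u <= k.+1%:R^-1].
  move=> k; apply: contrapT => no; apply: nB; exists k.+1%:R => u Wu.
  rewrite leNgt; apply/negP => uk; apply: no.
  have u0 : 0 < l1norm u by apply: le_lt_trans uk; rewrite mulr_ge0 // N_ge0.
  have [Wu' l1norm'] := scl u Wu (lt0r_neq0 u0).
  exists (ofR (l1norm u)^-1 *: u); split => //.
  rewrite NZ // absF_of ger0_norm ?invr_ge0 ?l1norm_ge0 // mulrC ler_pdivrMr //.
  by rewrite mulrC ler_pdivlMr // mulrC ltW.
have [|z zP] := @bounded_cluster u 1; first by move=> k; case: (uP k) => _ ->.
have Wz : W z.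
  suff -> : z = pi z by exact: Wsum.
  apply/eqP; rewrite -subr_eq0; apply/eqP/l1norm_eq0/eqP.
  rewrite eq_le l1norm_ge0 andbT; apply/ler_addgt0Pr => e e0; rewrite add0r.
  have D1 : 0 < 1 + D' by rewrite ltr_pwDl.
  have [|k _ uz] := zP (e / (1 + D')) 0%N; first by rewrite divr_gt0.
  have [Wu _ _] := uP k.
  apply: le_trans (l1norm_triangle _ (u k) _) _.
  have -> : u k - pi z = pi (u k - z).
    rewrite [X in X - _](piE _ Wu) /pi -sumrB; apply: eq_bigr => j _.
    by rewrite /coef mulmxBl !mxE -scalerBl.
  rewrite l1normB (@le_trans _ _ ((1 + D') * l1norm (u k - z))) //.
    by rewrite mulrDl mul1r lerD2l pib.
  by rewrite -ler_pdivlMl // mulrC ltW.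
have : N z = 0.
  apply/eqP; rewrite eq_le N_ge0 // andbT; apply/ler_addgt0Pr => e e0; rewrite add0r.
  have D1 : 0 < 1 + D by rewrite ltr_pwDl.
  have e2 : 0 < e / 2 by rewrite divr_gt0.
  have [K _ KH] := near_infty_natSinv_lt (PosNum e2).
  have [|k Kk uz] := zP (e / 2 / (1 + D)) K; first by rewrite divr_gt0.
  have [Wu _ Nu] := uP k.
  have Wzu : W (z - u k) by apply: WD => //; rewrite -scaleN1r; exact: WZ.
  rewrite -[z](subrK (u k)) (le_trans (ND Wzu Wu)) // [e]splitr lerD //.
    rewrite (le_trans (Nub _ Wzu)) // l1normB (@le_trans _ _ ((1 + D) * l1norm (u k - z))) //.
      by rewrite ler_wpM2r ?l1norm_ge0 // lerDr.
    by rewrite -ler_pdivlMl // mulrC ltW.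
  by rewrite (le_trans Nu) // ltW //; exact: KH.
move=> /(N_eq0 Wz) z0; have [|k _] := zP 1 0%N; first by [].
by rewrite z0 subr0; case: (uP k) => _ -> _; rewrite ltxx.
Qed.

End NormBound.

(** * Averaging over disjoint sets *)

Section Cells.
Context (R : realType) (s : scalars) (n : nat).
Local Notation FF := (scalarF R s).
Local Notation V := 'rV[FF]_n.
Local Notation ofR := (@ofR R s).
Context (d : measure_display) (T : measurableType d)
  (mu : {sigma_finite_measure set T -> \bar R}).
Variable X : dirBFS s n mu.
Variable P : set (set T).
Hypothesis tP : trivIset P id.
Hypothesis mP : forall E, P E -> measurable E /\ (0 < mu E < +oo)%E.
Implicit Types (f g : T -> V) (F : T -> set V) (E : set T).

Lemma countable_cells : countable P.
Proof.
apply: (countable_disjoint (mu := mu) tP) => E PE.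
by have [mE /andP[E0 _]] := mP PE.
Qed.

Lemma ae_forall_cells (Q : set T -> T -> Prop) :
  (forall E, P E -> {ae mu, forall x, Q E x}) ->
  {ae mu, forall x, forall E, P E -> Q E x}.
Proof.
move=> aQ; have /countable_injP[g ginj] := countable_cells.
have : {ae mu, forall x, forall k : nat, forall E, P E -> g E = k -> Q E x}.
  apply: ae_foralln => k.
  have [[E [PE gE]]|no] := pselect (exists E, P E /\ g E = k).
    apply: filterS (aQ E PE) => x QE E' PE' gE'.
    by have -> : E' = E by apply: ginj; rewrite ?inE // gE'.
  by apply: aeW => x E PE gE; case: no; exists E.
by apply: filterS => x H E PE; exact: (H (g E)).
Qed.

Lemma TP_glueV f : TP mu P f = glueV P (fun E _ => avg mu E f).
Proof.
apply/funext => x; rewrite /TP.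
have [[E PE Ex]|no] := pselect (exists2 E, P E & E x).
  rewrite (glueV_in _ tP PE Ex) -(@fsbig_widen _ _ _ _ [set E]) ?fsbig_set1.
  - by rewrite indicE mem_set // scale1r.
  - by move=> _ ->.
  - move=> E' [PE' /= nE]; rewrite indicE memNset ?scale0r // => E'x.
    by apply: nE; apply: tP => //; exists x.
rewrite glueV_out //; apply: fsbig1 => E PE.
by rewrite indicE memNset ?scale0r // => Ex; apply: no; exists E.
Qed.

Lemma TP_in f E x : P E -> E x -> TP mu P f x = avg mu E f.
Proof. by move=> PE Ex; rewrite TP_glueV (glueV_in _ tP PE Ex). Qed.

Lemma L0_TP f : L0 (TP mu P f).
Proof.
rewrite TP_glueV; apply: L0_glueV => //; first exact: countable_cells.
- by move=> E /mP[].
- by move=> E _; exact: L0_cst.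
Qed.

Lemma TPK_in F E x : P E -> E x -> TPK mu P F x = avgK mu E F.
Proof.
move=> PE Ex; apply/seteqP; split => v /=; last by left; exists E.
case=> [[E' [PE' E'x]]|[no _]]; last by case: no; exists E.
by rewrite (tP PE' PE) //; exists x.
Qed.

Lemma TPK_out F x : ~ (exists2 E, P E & E x) -> TPK mu P F x = [set 0].
Proof.
move=> no; apply/seteqP; split => v /=; last by right.
by case=> [[E [PE Ex _]]|[]] //; case: no; exists E.
Qed.

Lemma bfs_norm0 : bfs_norm X (fun=> 0) = 0.
Proof.
have := bfs_norm_scale (0 : FF) (bfs_0 X); rewrite absF_0 mul0r => <-.
by congr bfs_norm; apply/funext => x; rewrite scaler0.
Qed.

Lemma bfs_sum m (h : nat -> T -> V) (B : R) :
  (forall j, (j < m)%N -> bfs_set X (h j) /\ bfs_norm X (h j) <= B) ->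
  bfs_set X (fun x => \sum_(j < m) h j x) /\
  bfs_norm X (fun x => \sum_(j < m) h j x) <= m%:R * B.
Proof.
elim: m => [|m IH] hB.
  rewrite mul0r (_ : (fun x => _) = (fun=> 0)).
    by rewrite bfs_norm0; split => //; exact: bfs_0.
  by apply/funext => x; rewrite big_ord0.
have [|Sm Nm] := IH; first by move=> j jm; apply: hB; exact: ltnW.
have [Sh Nh] := hB m (ltnSn m).
rewrite (_ : (fun x => _) = (fun x => \sum_(j < m) h j x + h m x)); last first.
  by apply/funext => x; rewrite big_ord_recr.
split; first exact: bfs_add.
by rewrite (le_trans (bfs_norm_add Sm Sh)) // -natr1 mulrDl mul1r lerD.
Qed.

Lemma bfs_mask E (f g : T -> V) : measurable E -> bfs_set X f -> L0 g ->
  (forall x, E x -> g x = f x) ->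
  bfs_set X (piece E g (fun=> 0)) /\ bfs_norm X (piece E g (fun=> 0)) <= bfs_norm X f.
Proof.
move=> mE Xf mg gf; apply: bfs_ideal => //; first by apply: L0_piece => //; exact: L0_cst.
apply: aeW => x; apply: Kof_sub; rewrite /piece; case: ifPn.
  by rewrite inE => Ex; rewrite gf //; exact: Kof_self.
by exists 0; rewrite /= ?normr0 // scale0r.
Qed.

(** On the vectors v with v 1_E in X, the norm of v 1_E in X is a norm of v, because E
    is not a null set. *)
Lemma const_bound E : P E -> exists B : R, 0 <= B /\ forall v : V,
  bfs_set X (piece E (fun=> v) (fun=> 0)) ->
  l1norm v <= B * bfs_norm X (piece E (fun=> v) (fun=> 0)).
Proof.
move=> PE; have [mE /andP[E0 _]] := mP PE.
have pD (u v : V) : piece E (fun=> u + v) (fun=> 0) =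
    fun x => piece E (fun=> u) (fun=> 0) x + piece E (fun=> v) (fun=> 0) x.
  by apply/funext => x; rewrite /piece; case: ifP => // _; rewrite addr0.
have pZ l (u : V) : piece E (fun=> l *: u) (fun=> 0) =
    fun x => l *: piece E (fun=> u) (fun=> 0) x.
  by apply/funext => x; rewrite /piece; case: ifP => // _; rewrite scaler0.
have [|||||||B HB] := @norm_bound R s n [set v | bfs_set X (piece E (fun=> v) (fun=> 0))]
  (fun v => bfs_norm X (piece E (fun=> v) (fun=> 0))).
- rewrite /= (_ : piece _ _ _ = fun=> 0); first exact: bfs_0.
  by apply/funext => x; rewrite /piece; case: ifP.
- by move=> u v /= Wu Wv; rewrite pD; exact: bfs_add.
- by move=> l u /= Wu; rewrite pZ; exact: bfs_scale.
- by move=> u /= Wu; exact: bfs_norm_ge0.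
- by move=> u v /= Wu Wv; rewrite pD; exact: bfs_norm_add.
- by move=> l u /= Wu; rewrite pZ; exact: bfs_norm_scale.
- move=> u /= Wu /(bfs_norm_eq0 Wu) u0; apply: contrapT => l1norm0.
  have nE : mu.-negligible E.
    apply: negligibleS u0 => x Ex /=; rewrite /piece mem_set //.
  by have := measure_negligible mE nE => e; rewrite e ltxx in E0.
exists `|B|; split => // v Xv; apply: le_trans (HB v Xv) _.
by rewrite ler_wpM2r ?ler_norm // bfs_norm_ge0.
Qed.

End Cells.

(** * From functions to set-valued functions *)

Section Forward.
Context (R : realType) (s : scalars) (n : nat).
Local Notation FF := (scalarF R s).
Local Notation V := 'rV[FF]_n.
Local Notation ofR := (@ofR R s).
Context (d : measure_display) (T : measurableType d)
  (mu : {sigma_finite_measure set T -> \bar R}).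

Lemma integral_off (E : set T) (a : T -> R) : measurable E -> measurable_fun setT a ->
  {ae mu, forall x, ~ E x -> a x = 0} ->
  (\int[mu]_x (a x)%:E)%E = (\int[mu]_(x in E) (a x)%:E)%E.
Proof.
move=> mE ma a0; rewrite [RHS]integral_mkcond; apply: ae_eq_integral => //.
- exact/measurable_EFinP.
- apply/(measurable_restrictT _ mE)/measurable_EFinP; exact: measurable_funS ma.
- apply: filterS a0 => x ax _; rewrite patchE; case: ifPn => //.
  by rewrite notin_setE => /ax ->.
Qed.

Lemma integrable_off (E : set T) (a : T -> R) : measurable E -> measurable_fun setT a ->
  {ae mu, forall x, ~ E x -> a x = 0} ->
  mu.-integrable E (EFin \o a) -> mu.-integrable setT (EFin \o a).
Proof.
move=> mE ma a0 /integrableP [_ Ia]; apply/integrableP; split; first exact/measurable_EFinP.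
have -> : (\int[mu]_x `|(EFin \o a) x| = \int[mu]_(x in E) `|(EFin \o a) x|)%E.
  apply: (integral_off (a := fun x => `|a x|)) => //; first exact: measurableT_comp.
  by apply: filterS a0 => x ax /ax ->; rewrite normr0.
exact: Ia.
Qed.

Variable X : dirBFS s n mu.
Variable P : set (set T).
Hypothesis tP : trivIset P id.
Hypothesis mP : forall E, P E -> measurable E /\ (0 < mu E < +oo)%E.
Variable C0 : R.
Hypothesis C00 : 0 <= C0.
Hypothesis IP : forall f, bfs_set X f -> forall E, P E -> integrableV mu E f.
Hypothesis XTP : forall f, bfs_set X f -> bfs_set X (TP mu P f).
Hypothesis NTP : forall f, bfs_set X f -> bfs_norm X (TP mu P f) <= C0 * bfs_norm X f.
Variable F : T -> set V.
Hypothesis XF : XK X F.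

Let KF x : KK (F x). Proof. by case: XF => -[]. Qed.

Lemma normXK_ub f : S0 mu F f -> bfs_norm X f <= normXK X F.
Proof.
move=> Sf; case: XF => _ _ [M MH]; apply: ub_le_sup; last by exists f.
by exists M => _ [g Sg <-]; exact: MH.
Qed.

(** On E the function T_P f is constant, equal to the average of f. *)
Lemma avg_bound E : P E -> exists B : R,
  forall f, S0 mu (restrK E F) f -> l1norm (avg mu E f) <= B.
Proof.
move=> PE; have [mE /andP[E0 Efin]] := mP PE.
have [B [B0 HB]] := const_bound X mP PE.
exists (B * (C0 * normXK X F)) => f /(S0_restrK KF) Sf.
have Xf : bfs_set X f by case: XF => _ /(_ f Sf).
have [|Xc Nc] := bfs_mask (g := fun=> avg mu E f) mE (XTP Xf) (L0_cst _) => [x Ex|].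
  by rewrite (TP_in mu tP f PE Ex).
apply: le_trans (HB _ Xc) _; rewrite ler_wpM2l // (le_trans Nc) // (le_trans (NTP Xf)) //.
by rewrite ler_wpM2l // normXK_ub.
Qed.

(** For a coordinate i let g be f where this coordinate is nonnegative and -f elsewhere:
    g is a selection too, its i-th coordinate is |f_i|, and [avg_bound] applies to g. *)
Lemma integral_l1norm_bounded E : P E -> exists M : R, forall f, S0 mu (restrK E F) f ->
  integrableV mu E f /\ (\int[mu]_(x in E) (l1norm (f x))%:E <= M%:E)%E.
Proof.
move=> PE; have [mE /andP[E0 Efin]] := mP PE.
have E0' : 0 < fine (mu E) by rewrite fine_gt0 // E0.
have [B HB] := avg_bound PE.
have KrF := KK_restrK E KF.
have XS f : S0 mu (restrK E F) f -> bfs_set X f.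
  by move=> /(S0_restrK KF) Sf; case: XF => _ /(_ f Sf).
have IS f : S0 mu (restrK E F) f -> integrableV mu E f by move=> /XS Xf; exact: IP.
exists (\sum_(i : 'I_n * bool) fine (mu E) * B) => f Sf; split; first exact: IS.
have /integrableV_rcoord If := IS f Sf.
have mf : L0 f by case: Sf.
rewrite /l1norm; under eq_integral do rewrite -sumEFin.
rewrite ge0_integral_sum //; last first.
  move=> i; apply/measurable_EFinP; apply: measurableT_comp => //.
  by move/L0P: mf => /(_ i); exact: measurable_funS.
rewrite -sumEFin; apply: lee_sum => i _.
pose A := [set x | 0 <= rcoord (f x) i].
pose g := piece A f (fun x => (- 1) *: f x).
have Sg : S0 mu (restrK E F) g.
  apply: S0_piece => //; last by apply: S0_Z => //; rewrite normrN1.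
  by apply: measurable_set_le => //; move/L0P: mf.
have gE x : rcoord (g x) i = `|rcoord (f x) i|.
  rewrite /g /piece; case: ifPn; first by rewrite inE /A /= => /ger0_norm ->.
  rewrite notin_setE /A /= => /negP; rewrite -ltNge => /ltr0_norm ->.
  by rewrite scaleN1r rcoordN.
have /integrableV_rcoord /(_ i) Ig := IS g Sg.
have -> : (\int[mu]_(x in E) (`|rcoord (f x) i|)%:E =
    (\int[mu]_(x in E) rcoord (g x) i)%:E)%E.
  rewrite /Rintegral fineK; last exact: integrable_fin_num.
  by apply: eq_integral => x _ /=; rewrite gE.
rewrite lee_fin -ler_pdivrMl //.
have := HB g Sg; apply: le_trans; apply: le_trans (rcoord_le_l1norm _ i).
by rewrite rcoord_avg ler_norm.
Qed.

Lemma L1K_restr E : P E -> L1K mu (restrK E F).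
Proof.
move=> PE; have [mE /andP[E0 Efin]] := mP PE.
split; first by apply: L0K_restrK => //; case: XF.
have [M MH] := integral_l1norm_bounded PE; exists M => f Sf.
have [/integrableV_rcoord If fM] := MH f Sf; have [mf Ff] := Sf.
have f0 : {ae mu, forall x, ~ E x -> f x = 0}.
  by apply: filterS Ff => x + Ex; rewrite restrK_out.
split.
  apply/integrableV_rcoord => i; apply: (integrable_off mE) => //.
    by move/L0P: mf.
  by apply: filterS f0 => x fx /fx ->; rewrite rcoord0.
rewrite -(integral_off mE) in fM; first last.
- by apply: filterS f0 => x fx /fx ->; rewrite l1norm0.
- exact: measurable_l1norm.
apply: le_trans fM; apply: ge0_le_integral => //.
- by move=> x _; rewrite lee_fin enorm_ge0.
- apply/measurable_EFinP.
  rewrite /enormF; under eq_fun do rewrite dot_rcoord.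
  have -> : (fun x => Num.sqrt (\sum_i rcoord (f x) i ^+ 2)) =
      (@powR R ^~ 2^-1) \o (fun x => sqnorm (f x)).
    by apply/funext => x /=; rewrite powR12_sqrt // sqnorm_ge0.
  apply: measurableT_comp => //; exact: measurable_sqnorm.
- by apply/measurable_EFinP; exact: measurable_l1norm.
- by move=> x _; rewrite lee_fin enorm_le_l1norm.
Qed.

Lemma KK_avgK E : P E -> KK (avgK mu E F).
Proof.
move=> PE; have [mE /andP[E0 Efin]] := mP PE.
have [M MH] := integral_l1norm_bounded PE; have KrF := KK_restrK E KF.
apply: KK_build.
- by exists (avg mu E (fun=> 0)), (fun=> 0) => //; exact: S0_zero.
- move=> u uH; have [|f Sf fu] := avg_attained KrF mE Efin MH (v := u).
    by move=> e e0; have [_ [f Sf <-] fu] := uH e e0; exists f.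
  by exists f.
- move=> _ _ t t01 [f Sf <-] [g Sg <-].
  exists (fun x => ofR t *: f x + ofR (1 - t) *: g x); first exact: S0_conv.
  by have [[If _] [Ig _]] := (MH f Sf, MH g Sg); rewrite avg_comb.
- move=> _ l [f Sf <-] l1; exists (fun x => l *: f x); first exact: S0_Z.
  by have [If _] := MH f Sf; rewrite avg_Z.
Qed.

Lemma L0K_TPK : L0K (TPK mu P F).
Proof.
split => [x|U oU].
  have [[E PE Ex]|no] := pselect (exists2 E, P E & E x).
    by rewrite (TPK_in mu tP F PE Ex); exact: KK_avgK.
  by rewrite (TPK_out mu F no); exact: KK_set0.
have -> : [set x | TPK mu P F x `&` U !=set0] =
    (\bigcup_(E in P) (E `&` [set x | avgK mu E F `&` U !=set0])) `|`
    (~` (\bigcup_(E in P) E) `&` [set x | U (0 : V)]).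
  apply/seteqP; split => x /=.
    have [[E PE Ex]|no] := pselect (exists2 E, P E & E x).
      by rewrite (TPK_in mu tP F PE Ex) => H; left; exists E.
    rewrite (TPK_out mu F no) => -[_ [-> U0]]; right; split => //.
  case=> [[E PE [Ex H]]|[no U0]]; first by rewrite (TPK_in mu tP F PE Ex).
  have no' : ~ (exists2 E, P E & E x) by move=> [E PE Ex]; apply: no; exists E.
  by rewrite (TPK_out mu F no'); exists 0.
have cP := countable_cells tP mP.
apply: measurableU.
  apply: countable_bigcup_measurable => // E PE; apply: measurableI; last exact: measurable_Prop.
  by case: (mP PE).
apply: measurableI; last exact: measurable_Prop.
apply: measurableC; apply: countable_bigcup_measurable => // E PE.
by case: (mP PE).
Qed.

(** On each cell E choose, by [near_basis], n selections whose averages span <F>_E with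
    bounded coefficients, and let f_j glue the j-th choices.  A selection g of T_P F
    is then the sum over j of h_j, where h_j(x) is the j-th coefficient of g(x) times
    T_P f_j(x); the coefficients are linear in g(x), so h_j is measurable, and h_j is
    in X by the ideal property. *)
Lemma TPK_selection g : S0 mu (TPK mu P F) g ->
  bfs_set X g /\
  bfs_norm X g <= n%:R * ((basis_const R n + 1) * (C0 * normXK X F)).
Proof.
move=> [mg Fg]; pose C := basis_const R n + 1.
have C1 : 0 < C by rewrite ltr_pwDr // basis_const_ge0.
have cP := countable_cells tP mP.
have /choice [pl plP] : forall E, exists pl : (nat -> T -> V) * (nat -> 'cV[FF]_n), P E ->
    (forall j, S0 mu (restrK E F) (pl.1 j)) /\
    forall f, S0 mu (restrK E F) f ->
      avg mu E f = \sum_(j < n) coef (avg mu E f) (pl.2 j) *: avg mu E (pl.1 j) /\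
      forall j, (j < n)%N -> absF (coef (avg mu E f) (pl.2 j)) <= basis_const R n.
  move=> E; have [PE|nPE] := pselect (P E); last by exists (fun _ _ => 0, fun=> 0).
  have [B HB] := avg_bound PE.
  have Sz := S0_zero mu (KK_restrK E KF).
  have [||p [l pl]] := @near_basis R s n n {f | S0 mu (restrK E F) f}
      (exist _ _ Sz) (fun f => avg mu E (sval f)) B.
  - by move=> [f Sf] k /=; apply: le_trans (absF_le_l1norm _ k) (HB f Sf).
  - by move=> i k nk; have := ltn_ord k; rewrite ltnNge nk.
  exists (fun j => sval (p j), l) => _; split => [j|f Sf] /=; first exact: svalP (p j).
  exact: (pl (exist _ f Sf)).
pose f_ j := glueV P (fun E => (pl E).1 j).
have Sf j : S0 mu F (f_ j).
  split.
    apply: L0_glueV => // [E /mP[]//|E PE]; by have [/(_ j) []] := plP E PE.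
  have : {ae mu, forall x, forall E, P E -> restrK E F x ((pl E).1 j x)}.
    by apply: (ae_forall_cells tP mP) => E PE; have [/(_ j) []] := plP E PE.
  apply: filterS => x H.
  have [[E PE Ex]|no] := pselect (exists2 E, P E & E x).
    by rewrite /f_ (glueV_in _ tP PE Ex); have := H E PE; rewrite restrK_in.
  by rewrite /f_ (glueV_out _ no); exact: KK_0.
have Xf j : bfs_set X (f_ j) by case: XF => _ /(_ _ (Sf j)).
have TPf j E x : P E -> E x -> TP mu P (f_ j) x = avg mu E ((pl E).1 j).
  move=> PE Ex; rewrite (TP_in mu tP _ PE Ex); apply: eq_avg => y Ey.
  by rewrite /f_ (glueV_in _ tP PE Ey).
pose h j := glueV P (fun E x => coef (g x) ((pl E).2 j) *: avg mu E ((pl E).1 j)).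
have mh j : L0 (h j).
  apply: L0_glueV => // [E /mP[]//|E PE].
  by apply: L0_Z; [exact: measF_mulmx|exact: L0_cst].
have hB j : (j < n)%N -> bfs_set X (h j) /\ bfs_norm X (h j) <= C * (C0 * normXK X F).
  move=> jn; have XT := XTP (Xf j).
  have [|Xh Nh] := @bfs_ideal _ _ _ _ _ _ X _ (h j) (bfs_scale (ofR C) XT) (mh j).
    apply: filterS Fg => x gx; apply: Kof_sub.
    have [[E PE Ex]|no] := pselect (exists2 E, P E & E x); last first.
      by rewrite /h (glueV_out _ no); exists 0; rewrite /= ?normr0 // scale0r.
    rewrite /h (glueV_in _ tP PE Ex) (TPf j E x PE Ex).
    move: gx; rewrite (TPK_in mu tP F PE Ex) => -[f Sf' fg].
    have [_ /(_ f Sf') [_ /(_ j jn)]] := plP E PE; rewrite fg => cC.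
    exists (coef (g x) ((pl E).2 j) / ofR C); last first.
      rewrite scalerA divfK // -absF_eq0 absF_of gtr0_norm // gt_eqF //.
    rewrite /= -(ofR1 R s) -absF_le absF_M absF_V absF_of gtr0_norm //.
    by rewrite ler_pdivrMr // mul1r (le_trans cC) // lerDl.
  split => //; apply: le_trans Nh _; rewrite bfs_norm_scale // absF_of gtr0_norm //.
  rewrite ler_pM2l // (le_trans (NTP (Xf j))) // ler_wpM2l //; exact: normXK_ub.
have [Xs Ns] := bfs_sum hB.
have [|Xg Ng] := bfs_ae Xs mg; last by rewrite Ng.
apply: filterS Fg => x.
have [[E PE Ex]|no] := pselect (exists2 E, P E & E x).
  rewrite (TPK_in mu tP F PE Ex) => -[f Sf' fg].
  have [_ /(_ f Sf') [+ _]] := plP E PE; rewrite fg => ->.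
  by apply: eq_bigr => j _; rewrite /h (glueV_in _ tP PE Ex).
rewrite (TPK_out mu F no) => ->; rewrite big1 // => j _.
by rewrite /h (glueV_out _ no).
Qed.

End Forward.

(** * From set-valued functions to functions *)

Section Backward.
Context (R : realType) (s : scalars) (n : nat).
Local Notation FF := (scalarF R s).
Local Notation V := 'rV[FF]_n.
Local Notation ofR := (@ofR R s).
Context (d : measure_display) (T : measurableType d)
  (mu : {sigma_finite_measure set T -> \bar R}).

(** Shrinking l by the factor 1 - t leaves room for a rational approximation that stays
    in the unit disc. *)
Lemma disc_dense (l : FF) (t : R) : `|l| <= 1 -> 0 < t <= 1 ->
  exists p : rat * rat, let z := mkF s (ratr p.1) (ratr p.2) : FF in
    `|z| <= 1 /\ absF (z - l) <= 2 * t.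
Proof.
move=> l1 /andP[t0 t1].
pose m := ofR (1 - t) * l.
have h2 : 0 < t / 2 by rewrite divr_gt0.
have H (a : R) : exists r : rat, `|ratr r - a| <= t / 2.
  have [|r /=] := @rat_in_itvoo R (a - t / 2) a; first by rewrite ltrBlDr ltrDl.
  rewrite in_itv /= => /andP[r1 r2]; exists r; rewrite distrC ger0_norm; lra.
have [a ha] := H (reF m); have [b hb] := H (imF m); exists (a, b) => /=.
set z := mkF _ _ _.
have zm : absF (z - m) <= t.
  rewrite (le_trans (absF_ub _)) // reF_D imF_D reF_N imF_N /z reF_mk [t]splitr lerD //.
  move: hb; rewrite /z; move: m {ha z}; rewrite /imF /mkF; case: (s) => //= m hb.
  by rewrite subr0 normr0 ltW.
rewrite -(ofR1 R s) -absF_le in l1.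
have ml : absF (m - l) <= t.
  have -> : m - l = ofR (- t) * l by rewrite /m ofRD ofRN ofR1; ring.
  by rewrite absF_M absF_of normrN gtr0_norm // ler_piMr // ltW.
split.
  rewrite -(ofR1 R s) -absF_le -[z](subrK m) (le_trans (absF_D _ _)) //.
  have : absF m <= 1 - t.
    by rewrite /m absF_M absF_of ger0_norm ?subr_ge0 // ler_piMr // subr_ge0.
  by lra.
have -> : z - l = (z - m) + (m - l) by rewrite addrA subrK.
by rewrite (le_trans (absF_D _ _)) // mulr2n mulrDl mul1r lerD.
Qed.

(** A disc meets an open set iff one of its points with rational coefficient lies in
    it, so countably many preimages suffice. *)
Lemma L0K_Kof (f : T -> V) : L0 f -> L0K (fun x => Kof (f x)).
Proof.
move=> mf; split => [x|U oU]; first exact: KK_Kof.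
pose z (p : rat * rat) : FF := mkF s (ratr p.1) (ratr p.2).
have -> : [set x | Kof (f x) `&` U !=set0] =
    \bigcup_(p in [set p | `|z p| <= 1]) [set x | U (z p *: f x)].
  apply/seteqP; split => x /=; last first.
    by move=> [p /= p1 Up]; exists (z p *: f x); split => //; exists (z p).
  move=> [_ [[l /= l1 <-] Ul]].
  have [e [e0 eU]] := (open_l1norm U).1 oU _ Ul.
  have D0 : 0 < e + 8 * l1norm (f x) by rewrite ltr_pwDl // mulr_ge0 ?l1norm_ge0.
  pose t := e / (e + 8 * l1norm (f x)).
  have t0 : 0 < t by rewrite divr_gt0.
  have t1 : t <= 1 by rewrite ler_pdivrMr // mul1r lerDl mulr_ge0 ?l1norm_ge0.
  have tD : t * (e + 8 * l1norm (f x)) = e by rewrite divfK // gt_eqF.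
  have [|p [p1 pl]] := disc_dense l1 (t := t); first by rewrite t0 t1.
  exists p => //=; apply: eU; rewrite -scalerBl (le_lt_trans (l1normZ _ _)) //.
  rewrite -/(z p) in pl.
  apply: (@le_lt_trans _ _ (2 * (2 * t) * l1norm (f x))).
    by rewrite ler_wpM2r ?l1norm_ge0 // ler_pM2l.
  have := l1norm_ge0 (f x); nra.
apply: countable_bigcup_measurable => // p _.
have mg : L0 (fun x => z p *: f x) by apply: L0_Z => //; exact: measF_cst.
rewrite -[X in measurable X]setTI; apply: mg => //.
exact: sub_sigma_algebra.
Qed.

Variable X : dirBFS s n mu.
Variable P : set (set T).
Hypothesis tP : trivIset P id.
Hypothesis mP : forall E, P E -> measurable E /\ (0 < mu E < +oo)%E.

Lemma Kof_sel f g : bfs_set X f -> S0 mu (fun x => Kof (f x)) g ->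
  bfs_set X g /\ bfs_norm X g <= bfs_norm X f.
Proof.
move=> Xf [mg fg]; apply: bfs_ideal => //.
by apply: filterS fg => x; exact: Kof_sub.
Qed.

Lemma S0_Kof f : bfs_set X f -> S0 mu (fun x => Kof (f x)) f.
Proof.
by move=> Xf; split; [exact: bfs_L0 Xf|apply: aeW => x; exact: Kof_self].
Qed.

Lemma XK_Kof f : bfs_set X f -> XK X (fun x => Kof (f x)).
Proof.
move=> Xf; split.
- by apply: L0K_Kof; exact: bfs_L0 Xf.
- by move=> g /(Kof_sel Xf)[].
- by exists (bfs_norm X f) => g /(Kof_sel Xf)[].
Qed.

Lemma normXK_Kof f : bfs_set X f -> normXK X (fun x => Kof (f x)) <= bfs_norm X f.
Proof.
move=> Xf; apply: ge_sup.
  by exists (bfs_norm X f), f => //; exact: S0_Kof.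
by move=> _ [g Sg <-]; have [] := Kof_sel Xf Sg.
Qed.

Lemma S0_TPK f : bfs_set X f -> S0 mu (TPK mu P (fun x => Kof (f x))) (TP mu P f).
Proof.
move=> Xf; split; first exact: L0_TP tP mP f.
apply: aeW => x; have [[E PE Ex]|no] := pselect (exists2 E, P E & E x).
  rewrite (TPK_in mu tP _ PE Ex) (TP_in mu tP f PE Ex).
  exists (piece E f (fun=> 0)).
    by apply: S0_mask; [case: (mP PE)|exact: S0_Kof].
  by apply: eq_avg => y Ey; rewrite /piece mem_set.
by rewrite (TPK_out mu _ no) TP_glueV // glueV_out.
Qed.

Lemma TPK_bound_TP C : (forall F, XK X F -> XK X (TPK mu P F)) ->
  TPK_bound X P C -> TP_bound X P C.
Proof.
move=> XT [C0 CN]; split => // f Xf.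
apply: le_trans (normXK_ub (XT _ (XK_Kof Xf)) (S0_TPK Xf)) _.
apply: le_trans (CN _ (XK_Kof Xf)) _.
by rewrite ler_wpM2l // normXK_Kof.
Qed.

Lemma TPK_bounded_TP : TPK_bounded X P -> TP_bounded X P.
Proof.
move=> [LP XT [C CB]]; split.
- move=> f Xf E PE; have [mE _] := mP PE.
  have [_ [M MH]] := LP _ (XK_Kof Xf) E PE.
  have [/integrableV_rcoord If _] := MH _ (S0_mask mE (S0_Kof Xf)).
  apply/integrableV_rcoord => i.
  have := @integrableS _ _ _ mu setT E _ measurableT mE (@subsetT _ E) (If i).
  by apply: eq_integrable => // x; rewrite inE => Ex; rewrite /= /piece mem_set.
- move=> f Xf; have [_ XS _] := XT _ (XK_Kof Xf).
  exact: XS (S0_TPK Xf).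
- by exists C; exact: TPK_bound_TP.
Qed.

Lemma TP_bound_TPK C : (forall f, bfs_set X f -> forall E, P E -> integrableV mu E f) ->
  (forall f, bfs_set X f -> bfs_set X (TP mu P f)) ->
  TP_bound X P C -> TPK_bound X P (n%:R * (basis_const R n + 1) * C).
Proof.
move=> IP XT [C0 CN]; split.
  by rewrite !mulr_ge0 // addr_ge0 // basis_const_ge0.
move=> F XF; apply: ge_sup.
  exists (bfs_norm X (fun=> 0)), (fun=> 0) => //; apply: S0_zero.
  by have [] := L0K_TPK tP mP C0 IP XT CN XF.
move=> _ [g Sg <-]; have [_ Ng] := TPK_selection tP mP C0 XT CN XF Sg.
by rewrite -!mulrA in Ng *.
Qed.

Lemma TP_bounded_TPK : TP_bounded X P -> TPK_bounded X P.
Proof.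
move=> [IP XT [C CB]]; have [C0 CN] := CB; split.
- by move=> F XF E PE; exact: (L1K_restr tP mP C0 IP XT CN XF).
- move=> F XF; split; first exact: (L0K_TPK tP mP C0 IP XT CN XF).
    by move=> g Sg; have [] := TPK_selection tP mP C0 XT CN XF Sg.
  exists (n%:R * ((basis_const R n + 1) * (C * normXK X F))) => g Sg.
  by have [] := TPK_selection tP mP C0 XT CN XF Sg.
- by exists (n%:R * (basis_const R n + 1) * C); exact: TP_bound_TPK IP XT CB.
Qed.

End Backward.

(** * Equivalence and comparison of the norms *)

Unset Implicit Arguments.

Theorem theorem4p4 (R : realType) (n : nat) (hn : (1 <= n)%N) :
  exists c C : R, [/\ 0 < c, 0 < C &
    forall (s : scalars) (d : measure_display) (T : measurableType d)
      (mu : {sigma_finite_measure set T -> \bar R})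
      (X : dirBFS s n mu) (P : set (set T)),
      trivIset P id ->
      (forall E, P E -> measurable E /\ (0 < mu E < +oo)%E) ->
      (TP_bounded X P <-> TPK_bounded X P) /\
      (TP_bounded X P ->
         c * TP_norm X P <= TPK_norm X P /\
         TPK_norm X P <= C * TP_norm X P)].
Proof.
have K0 : 0 < n%:R * (basis_const R n + 1).
  by rewrite mulr_gt0 ?ltr0n // ltr_pwDr // basis_const_ge0.
exists 1, (n%:R * (basis_const R n + 1)); split => // s d T mu X P tP mP.
split; first by split; [exact: TP_bounded_TPK|exact: TPK_bounded_TP].
move=> bT; have [IP XT [C1 CB1]] := bT; have [_ XKT [C2 CB2]] := TP_bounded_TPK tP mP bT.
have lbT : has_lbound [set C | TP_bound X P C] by exists 0 => C [].
have lbK : has_lbound [set C | TPK_bound X P C] by exists 0 => C [].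
rewrite mul1r; split.
  apply: lb_le_inf; first by exists C2.
  by move=> C CB; apply: ge_inf => //; exact: TPK_bound_TP tP mP _ XKT CB.
rewrite mulrC -ler_pdivrMr //; apply: lb_le_inf; first by exists C1.
move=> C CB; rewrite ler_pdivrMr // mulrC; apply: ge_inf => //.
exact: TP_bound_TPK.
Qed.
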